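(* For all integers $n\geq 1$ and $k\geq 2n-1$, $$\Sigma_{k,2n}=-\frac{1}{k}\,[u^{2n}t^{k+1}]\,\frac{1}{C(t)}\prod_{j=1}^{k-1}\Bigl(1+\sum_{i\geq 1}j^iP_i(t)u^it^i\Bigr),$$ and $$\Sigma_k=-\frac{1}{k}\,[t^{k+1}]\,\frac{1}{C(t)}\prod_{j=1}^{k-1}\Bigl(1+\sum_{i\geq 1}j^iP_i(t)t^i\Bigr).$$
   Context: Kerov's character polynomials. For $k\ge1$, $\Sigma_k$ denotes Kerov's character polynomial: the universal polynomial with integer coefficients in indeterminates $R_2,R_3,\ldots,R_{k+1}$ such that $\widehat{\chi}_\omega(k1^{n-k})=\Sigma_k(R_2(\omega),\ldots,R_{k+1}(\omega))$ for all partitions $\omega\vdash n$ and all $n\geq k$. Here $\widehat{\chi}_\omega(k1^{n-k})=n(n-1)\cdots(n-k+1)\,\chi_\omega(k1^{n-k})/\chi_\omega(1^n)$, where $\chi_\omega(\lambda)$ is the character of the irreducible representation of the symmetric group $\mathfrak{S}_n$ indexed by $\omega$ on the class of cycle type $\lambda$. The free cumulants $R_i(\omega)$ are defined by $z^{-1}+\sum_{i\ge1}R_i(\omega)z^{i-1}=H_\omega^{\langle -1\rangle}(z)$ (compositional inverse, $H_\omega$ being expanded in powers of $1/z$ at infinity), where $H_\omega(z)=\prod_{i=1}^{m-1}(z-y_i)/\prod_{i=1}^{m}(z-x_i)$, with $x_1,\ldots,x_m$ the local minima and $y_1,\ldots,y_{m-1}$ the local maxima of the boundary curve of the Young diagram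 of $\omega$ (French convention) rotated counterclockwise by $45^\circ$, scaled so that these are integers (i.e. the $x_i$ are the contents, column minus row, of the addable boxes of $\omega$, and the $y_i$ the contents of the removable boxes). Equivalently, by a known theorem (Okounkov, Biane, Stanley): with $R(x)=1+\sum_{i\ge2}R_ix^i$, $F(x)=x/R(x)$, $G(x)=1/F^{\langle-1\rangle}(x^{-1})$, where $\langle -1\rangle$ is compositional inverse, one has $\Sigma_k=-\frac1k[x^{-1}]_\infty\prod_{j=0}^{k-1}G(x-j)$, where $[x^{-1}]_\infty$ is the coefficient of $x^{-1}$ in the expansion at $x=\infty$ (in descending powers of $x$). Graded pieces: $\Sigma_{k,2n}=[u^{k+1-2n}]\,\Sigma_k(R_2u^2,R_3u^3,\ldots,R_{k+1}u^{k+1})$, i.e. the sum of all terms of weight $k+1-2n$ in $\Sigma_k$, where $R_{j_1}\cdots R_{j_i}$ has weight $j_1+\cdots+j_i$. $[t^r]$ and $[u^st^r]$ denote coefficient extraction. Series: $C(t)=\sum_{m\ge0}C_mt^m=\dfrac{1}{1-\sum_{i\geq 2}(i-1)R_it^i}$ (so $C_0=1$, $C_1=0$). With $D=t\frac{d}{dt}$ and $I$ the identity operator, for $m\ge1$ $$P_m(t)=-\frac{1}{m!}C(t)(D+(m-2)I)C(t)\cdots(D+I)C(t)\,D\,C(t),$$ where each operator acts on everything to its right; e.g. $P_1=-C$, $P_2=-\frac12C\,DC$, $P_3=-\frac16 C(D+I)(C\,DC)$. *)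

(* Defs.v *)
From HB Require Import structures.
From mathcomp Require Import all_boot all_order all_algebra all_fingroup.
From mathcomp Require Import all_solvable all_field all_character.
From mathcomp Require Import -(notations) monalg.
From mathcomp Require Import mpoly.

Set Implicit Arguments.
Unset Strict Implicit.
Unset Printing Implicit Defensive.

Import GRing.Theory Num.Theory.
Local Open Scope ring_scope.

(* The series a_0 + a_1 t + a_2 t^2 + ... is the function n |-> a_n. *)
Definition fps (A : Type) := nat -> A.

Section PowerSeries.
Variable A : comNzRingType.
Implicit Types (f g : fps A) (c : A).

Definition fps_const c : fps A := fun n => if n == 0%N then c else 0.
Definition fps_one : fps A := fps_const 1.
Definition fps_X : fps A := fun n => (n == 1%N)%:R.
Definition fps_add f g : fps A := fun n => f n + g n.
Definition fps_opp f : fps A := fun n => - f n.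
Definition fps_sub f g : fps A := fps_add f (fps_opp g).
Definition fps_scale c f : fps A := fun n => c * f n.
Definition fps_mul f g : fps A := fun n => \sum_(i < n.+1) f i * g (n - i)%N.
Definition fps_exp f m : fps A := iter m (fps_mul f) fps_one.

(* \sum_(i >= 1) F i t^i, where each F i is itself a series in t. *)
Definition fps_sum1 (F : nat -> fps A) : fps A :=
  fun n => \sum_(1 <= i < n.+1) F i (n - i)%N.

(* Composition f(g(t)); meaningful when g has zero constant term, since then
   g^m does not contribute to the coefficient of t^n for m > n. *)
Definition fps_comp f g : fps A := fun n => \sum_(m < n.+1) f m * fps_exp g m n.

(* Reciprocal of a series with constant term 1: 1 / f is the geometric series
   \sum_m (1 - f)^m, whose terms m > n vanish at t^n. *)
Definition fps_inv f : fps A :=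
  fun n => \sum_(m < n.+1) fps_exp (fps_sub fps_one f) m n.

(* The operator D + c I, with D = t d/dt. *)
Definition fps_DI (c : nat) f : fps A := fun n => f n *+ n + f n *+ c.

End PowerSeries.

(* Partitions: weakly decreasing sequences of positive integers; row i of the
   Young diagram has boxes in columns 0, ..., nth 0 w i - 1. *)
Definition is_partition (w : seq nat) : bool := sorted geq w && (0%N \notin w).

(* Contents (column minus row) of the addable and of the removable boxes. *)
Definition addable_contents (w : seq nat) : seq int :=
  [seq (nth 0%N w i)%:Z - i%:Z | i <- iota 0 (size w).+1 &
     (i == 0%N) || (nth 0%N w i < nth 0%N w i.-1)%N].
Definition removable_contents (w : seq nat) : seq int :=
  [seq (nth 0%N w i)%:Z - 1 - i%:Z | i <- iota 0 (size w) &
     (nth 0%N w i.+1 < nth 0%N w i)%N].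

(* H_w(z) as a power series in v = 1/z: since there is one more x than y,
   H_w = v \prod_y (1 - y v) / \prod_x (1 - x v). *)
Definition H_series (w : seq nat) : fps algC :=
  fps_mul (fps_X algC)
    (fps_mul
      (\big[@fps_mul algC/fps_one algC]_(y <- removable_contents w)
         fps_sub (fps_one algC) (fps_scale y%:~R (fps_X algC)))
      (\big[@fps_mul algC/fps_one algC]_(x <- addable_contents w)
         fps_inv (fps_sub (fps_one algC) (fps_scale x%:~R (fps_X algC))))).

(* r 1, r 2, ... are the free cumulants of w (r 0 is irrelevant): if
   K(z) = z^-1 + \sum_(i >= 1) r_i z^(i-1), then H_w(K(z)) = z.  H_series is
   in powers of 1/z, so what is substituted in it is
   1 / K(z) = z / (1 + \sum_(i >= 1) r_i z^i). *)
Definition free_cumulants (w : seq nat) (r : nat -> algC) : Prop :=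
  fps_comp (H_series w)
    (fps_mul (fps_X algC) (fps_inv (fun i => if i == 0%N then 1 else r i)))
  =1 fps_X algC.

Definition fun_stab n (f : 'I_n -> nat) : {set 'S_n} :=
  [set s : 'S_n | [forall x, f (s x) == f x]].

Lemma fun_stab_group_set n (f : 'I_n -> nat) : group_set (fun_stab f).
Proof.
apply/group_setP; split=> [|s t]; first by rewrite inE; apply/forallP=> x; rewrite perm1.
rewrite !inE => /forallP fs /forallP ft; apply/forallP=> x.
by rewrite permM (eqP (ft _)).
Qed.

Canonical fun_stab_group n (f : 'I_n -> nat) := Group (fun_stab_group_set f).

Lemma sign_cfun_subproof n (G : {group 'S_n}) :
  is_class_fun <<G>>%g [ffun s : 'S_n => (-1) ^+ s *+ (s \in G) : algC].
Proof.
rewrite genGid; apply: intro_class_fun => [s t Gs Gt | s /negbTE->] //.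
by rewrite groupJ // Gs !odd_permM odd_permV addbC addbK.
Qed.

Definition sign_cfun n (G : {group 'S_n}) : 'CF(G) :=
  Cfun 0 (sign_cfun_subproof G).

(* The boxes of the diagram of w are numbered row by row by 'I_(sumn w):
   reshape_index and reshape_offset give the row and the column of a box. *)
Definition row_stab (w : seq nat) : {group 'S_(sumn w)} :=
  [group of fun_stab (fun x : 'I_(sumn w) => reshape_index w x)].
Definition col_stab (w : seq nat) : {group 'S_(sumn w)} :=
  [group of fun_stab (fun x : 'I_(sumn w) => reshape_offset w x)].

(* The irreducible representation indexed by w is the unique common
   constituent of the representations induced by the trivial representation
   of the row stabiliser and by the sign of the column stabiliser. *)
Definition sym_Iirr (w : seq nat) : Iirr [set: 'S_(sumn w)] :=
  odflt 0 [pick i |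
    (i \in irr_constt ('Ind[[set: 'S_(sumn w)], row_stab w] 1)) &&
    (i \in irr_constt ('Ind[[set: 'S_(sumn w)], col_stab w]
                         (sign_cfun (col_stab w))))].

Definition sym_chi (w : seq nat) : 'CF([set: 'S_(sumn w)]) := 'chi_(sym_Iirr w).

Definition has_cycle_type n (s : 'S_n) (l : seq nat) : bool :=
  perm_eq [seq #|X| | X : {set 'I_n} <- enum (porbits s)] l.

(* S is the k-th Kerov polynomial; 'X_i, i < k, stands for R_(i + 2). *)
Definition is_kerov_polynomial (k : nat) (S : {mpoly int[k]}) : Prop :=
  forall (w : seq nat) (r : nat -> algC) (s : 'S_(sumn w)),
    is_partition w -> (k <= sumn w)%N -> free_cumulants w r ->
    has_cycle_type s (k :: nseq (sumn w - k) 1%N) ->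
    (sumn w ^_ k)%:R * sym_chi w s / sym_chi w 1%g
      = mmap intr (fun i : 'I_k => r i.+2) S.

(* Q[R_0, R_1, R_2, ...]; R_0 and R_1 are never used. *)
Definition QR : comAlgType rat := monalg.malg (monalg.cmonom nat) rat.
Definition indet (i : nat) : QR := monalg.mkmalgU (monalg.ucm i) 1.

Section KerovSeries.
Variables (A : comAlgType rat) (R : nat -> A).

(* [u^d] S(R_2 u^2, ..., R_(k+1) u^(k+1)) *)
Definition weight_part k (S : {mpoly int[k]}) (d : nat) : A :=
  (mmap intr (fun i : 'I_k => (R i.+2)%:P * 'X^(i.+2)) S : {poly A})`_d.

Definition kerov_eval k (S : {mpoly int[k]}) : A :=
  mmap intr (fun i : 'I_k => R i.+2) S.

Definition C_series : fps A :=
  fps_inv (fps_sub (fps_one A)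
    (fun i => if (2 <= i)%N then R i *+ i.-1 else 0)).

(* PQ_series m = - m! P_m for m >= 1. *)
Fixpoint PQ_series (m : nat) : fps A :=
  match m with
  | 0 => fps_one A
  | 1 => C_series
  | (m'.+1 as m1).+1 => fps_mul C_series (fps_DI m' (PQ_series m1))
  end.

Definition P_series (m : nat) : fps A :=
  fun n => - ((m`!)%:R^-1 : rat) *: PQ_series m n.

(* 1 + \sum_(i >= 1) j^i P_i(t) t^i *)
Definition P_factor (j : nat) : fps A :=
  fps_add (fps_one A) (fps_sum1 (fun i n => P_series i n *+ (j ^ i))).

(* 1 + \sum_(i >= 1) j^i P_i(t) u^i t^i, as a series in t over A[u] *)
Definition P_factor_u (j : nat) : fps {poly A} :=
  fps_add (fps_one {poly A})
    (fps_sum1 (fun i n => (P_series i n *+ (j ^ i)) *: 'X^i)).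

Definition kerov_series (k : nat) : fps A :=
  fps_mul (fps_inv C_series)
    (\big[@fps_mul A/fps_one A]_(1 <= j < k) P_factor j).

Definition kerov_series_u (k : nat) : fps {poly A} :=
  fps_mul (fun n => (fps_inv C_series n)%:P)
    (\big[@fps_mul {poly A}/fps_one {poly A}]_(1 <= j < k) P_factor_u j).

End KerovSeries.

(* Main.v *)
From HB Require Import structures.
Require Import Defs.
From mathcomp Require Import all_boot all_order all_algebra all_fingroup.
From mathcomp Require Import all_solvable all_field all_character.
From mathcomp Require Import mpoly.
From mathcomp Require Import ring lra zify.
From mathcomp Require boolp.

Set Implicit Arguments.
Unset Strict Implicit.
Unset Printing Implicit Defensive.
Import GRing.Theory Num.Theory.
Local Open Scope ring_scope.

(** The starting point is Frobenius' formula for the character of a partition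
    w at a k-cycle.  Let u_1, ..., u_L be the shifted parts w_i - i of w.  Then
    1 / H_w(z) = G(z) = (z + L) \prod_i (z - u_i - 1) / (z - u_i), and the
    normalised character is a sum over i of residues at z = u_i of the product
    G(z) G(z - 1) ... G(z - k + 1), in which the factors indexed by i
    telescope.  The residues add up to the coefficient of z^-1 at infinity,
    so that - k times the normalised character is that coefficient
    (partition_residue).

    The free cumulants enter by substituting z = R(t) / t, where
    R(t) = 1 + \sum_i R_i t^i; by definition G(R(t) / t) = 1 / t.  The
    coefficient of z^-1 becomes a coefficient in t, with Jacobian 1 / C
    (jacobi_residue), and d/dz becomes - t C D.  Hence the Taylor expansion
    of G(z - j) in powers of j has the coefficients obtained from 1 / t by
    iterating the operator t C D, which are the series P_i up to powers of t:
    t G(R(t) / t - j) is the factor 1 + \sum_i j^i P_i(t) t^i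
    (P_factor_comp, kerov_series_shift).

    Both sides are therefore equal at the free cumulants of every strict
    partition with k parts.  When the u_i are indeterminates, both sides are
    polynomials in the u_i, and strict partitions are dense enough to make
    these polynomials equal (mpoly_eq0_of_strict).  Finally, over an
    algebraically closed field every choice of R_2, ..., R_(k+1) is attained
    by some u (cumulant_surjective), so the identity holds for indeterminate
    cumulants and then in every commutative Q-algebra (kerov_formula).  The
    graded pieces follow by the scaling R_i -> c^i R_i (kerov_weight_formula).

    Frobenius' formula is proved as follows.  The alternating sum over s in
    S_L of the permutation characters on words of content
    w_i - i + s(i) is a virtual character.  Its norm is computed by counting
    matrices with prescribed margins; it is 1 by the bialternant formula
    (orthonormality, frobenius_norm), so up to sign the sum is irreducible.
    Inducing the sign of the column stabiliser gives a character orthogonal to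
    every term of the alternating sum with s != 1, by dominance, and with
    inner product 1 with the term s = 1; so the alternating sum is the common
    constituent that defines the character of w, up to sign
    (frobenius_sym_chi).  Evaluated at a k-cycle, the alternating sum is a sum
    of determinants of falling factorials, each a Lagrange interpolation
    factor times the one at the identity (frobenius_ratio). *)

(** * The ring of formal power series *)

Lemma fpsP (A : Type) (f g : fps A) : f =1 g -> f = g.
Proof. by move=> fg; apply: boolp.funext. Qed.

(* Series are functions, so that comparing or choosing them is classical. *)
HB.instance Definition _ (A : Type) := boolp.gen_eqMixin (fps A).
HB.instance Definition _ (A : Type) := boolp.gen_choiceMixin (fps A).

Section Ring.
Variable A : comNzRingType.
Implicit Types f g h : fps A.

Definition fps_trunc N f : {poly A} := \poly_(i < N.+1) f i.

Lemma fps_truncE N f n : (n <= N)%N -> (fps_trunc N f)`_n = f n.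
Proof. by move=> le_nN; rewrite coef_poly ltnS le_nN. Qed.

Lemma fps_mul_trunc N f g n : (n <= N)%N ->
  fps_mul f g n = (fps_trunc N f * fps_trunc N g)`_n.
Proof.
move=> le_nN; rewrite coefM; apply: eq_bigr => i _.
by rewrite !fps_truncE ?(leq_trans (leq_subr _ _)) // (leq_trans _ le_nN) // -ltnS.
Qed.

Fact fps_addA : associative (@fps_add A).
Proof. by move=> f g h; apply: fpsP => n; apply: addrA. Qed.
Fact fps_addC : commutative (@fps_add A).
Proof. by move=> f g; apply: fpsP => n; apply: addrC. Qed.
Fact fps_add0 : left_id (fun _ => 0) (@fps_add A).
Proof. by move=> f; apply: fpsP => n; apply: add0r. Qed.
Fact fps_addN : left_inverse (fun _ => 0) (@fps_opp A) (@fps_add A).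
Proof. by move=> f; apply: fpsP => n; apply: addNr. Qed.

HB.instance Definition _ := GRing.isZmodule.Build (fps A)
  fps_addA fps_addC fps_add0 fps_addN.

Fact fps_mulC : commutative (@fps_mul A).
Proof.
by move=> f g; apply: fpsP => n; rewrite !(@fps_mul_trunc n) // mulrC.
Qed.
Fact fps_mulA : associative (@fps_mul A).
Proof.
move=> f g h; apply: fpsP => n; rewrite !(@fps_mul_trunc n) //.
have tr e1 e2 i : (i <= n)%N ->
    (fps_trunc n (fps_mul e1 e2))`_i = (fps_trunc n e1 * fps_trunc n e2)`_i.
  by move=> le_in; rewrite fps_truncE // (fps_mul_trunc _ _ le_in).
transitivity ((fps_trunc n f * (fps_trunc n g * fps_trunc n h))`_n).
  by rewrite !coefM; apply: eq_bigr => i _; rewrite tr // leq_subr.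
rewrite mulrA !coefM; apply: eq_bigr => i _; rewrite tr //.
by rewrite -ltnS.
Qed.
Fact fps_mul1 : left_id (@fps_one A) (@fps_mul A).
Proof.
move=> f; apply: fpsP => n; rewrite /fps_mul big_ord_recl subn0 mul1r.
by rewrite big1 ?addr0 // => i _; rewrite mul0r.
Qed.
Fact fps_mulD : left_distributive (@fps_mul A) (@fps_add A).
Proof.
move=> f g h; apply: fpsP => n; rewrite /fps_add /fps_mul -big_split.
by apply: eq_bigr => i _; rewrite mulrDl.
Qed.
Fact fps_one_neq0 : fps_one A != 0.
Proof.
apply/eqP => /(congr1 (fun f : fps A => f 0%N)) /eqP.
by rewrite (oner_eq0 A).
Qed.

HB.instance Definition _ := GRing.Zmodule_isComNzRing.Build (fps A)
  fps_mulA fps_mulC fps_mul1 fps_mulD fps_one_neq0.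

Lemma fpsD f g n : (f + g) n = f n + g n. Proof. by []. Qed.
Lemma fpsN f n : (- f) n = - f n. Proof. by []. Qed.
Lemma fpsB f g n : (f - g) n = f n - g n. Proof. by []. Qed.
Lemma fps1 n : (1 : fps A) n = (n == 0%N)%:R. Proof. by case: n. Qed.
Lemma fpsM f g n : (f * g) n = \sum_(i < n.+1) f i * g (n - i)%N.
Proof. by []. Qed.
Lemma fpsM0 f g : (f * g) 0%N = f 0%N * g 0%N.
Proof. by rewrite fpsM big_ord1. Qed.
Lemma fps_sumE I (r : seq I) P (F : I -> fps A) n :
  (\sum_(i <- r | P i) F i) n = \sum_(i <- r | P i) F i n.
Proof. by elim/big_rec2: _ => // i x y _ <-. Qed.
Lemma fpsMn f m n : (f *+ m) n = f n *+ m.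
Proof. by elim: m => // m IHm; rewrite !mulrS fpsD IHm. Qed.
Lemma fps_expE f m : fps_exp f m = f ^+ m.
Proof. by elim: m => // m IHm; rewrite exprS -IHm. Qed.
Lemma fpsX0 f m : (f ^+ m) 0%N = f 0%N ^+ m.
Proof. by elim: m => // m IHm; rewrite !exprS fpsM0 IHm. Qed.

Lemma fps_prod0 I (r : seq I) P (F : I -> fps A) :
  (\prod_(i <- r | P i) F i) 0%N = \prod_(i <- r | P i) F i 0%N.
Proof. by elim/big_rec2: _ => // i x y _ <-; rewrite fpsM0. Qed.

Lemma fps_mulE : (@fps_mul A : fps A -> fps A -> fps A) = *%R. Proof. by []. Qed.
Lemma fps_bigE I (r : seq I) P (F : I -> fps A) :
  \big[@fps_mul A/fps_one A]_(i <- r | P i) F i = \prod_(i <- r | P i) F i.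
Proof. by []. Qed.

Local Notation T := (fps_X A).

Lemma fpsMX f n : (T * f) n = if n is m.+1 then f m else 0.
Proof.
rewrite fpsM; case: n => [|n]; first by rewrite big_ord1 mul0r.
rewrite 2!big_ord_recl mul0r add0r mul1r subn1 big1 ?addr0 // => i _.
by rewrite mul0r.
Qed.

Lemma fpsMXn m f n : (T ^+ m * f) n = if (m <= n)%N then f (n - m)%N else 0.
Proof.
elim: m n => [|m IHm] n; first by rewrite mul1r subn0.
by rewrite exprS -mulrA fpsMX; case: n => // n; rewrite IHm ltnS subSS.
Qed.

Lemma fps_sum1E (F : nat -> fps A) n N : (n <= N)%N ->
  fps_sum1 F n = (\sum_(1 <= i < N.+1) T ^+ i * F i) n.
Proof.
move=> le_nN; rewrite fps_sumE (@big_cat_nat _ _ _ n.+1) //= [X in _ + X]big1_seq.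
  rewrite addr0 /fps_sum1; apply: eq_big_nat => i /andP[_ le_in].
  by rewrite fpsMXn -ltnS le_in.
by move=> i /=; rewrite mem_index_iota fpsMXn (leqNgt i n) => /andP[-> _].
Qed.

Definition fpsC (c : A) : fps A := fps_const c.

Lemma fpsC_mul c f n : (fpsC c * f) n = c * f n.
Proof.
rewrite fpsM big_ord_recl subn0 big1 ?addr0 // => i _.
by rewrite mul0r.
Qed.

Fact fpsC_additive : additive fpsC.
Proof.
by move=> x y; apply: fpsP => -[|n] //=; rewrite fpsB /fpsC /fps_const /= subr0.
Qed.
Fact fpsC_multiplicative : multiplicative fpsC.
Proof.
split=> // x y; apply: fpsP => n; rewrite fpsC_mul.
by case: n => //=; rewrite /fpsC /fps_const /= ?mulr0.
Qed.
HB.instance Definition _ := GRing.isAdditive.Build A (fps A) fpsC fpsC_additive.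
HB.instance Definition _ :=
  GRing.isMultiplicative.Build A (fps A) fpsC fpsC_multiplicative.

Lemma fps_scaleE c f : fps_scale c f = fpsC c * f.
Proof. by apply: fpsP => n; rewrite fpsC_mul. Qed.

Lemma fps_exp_small f m n : f 0%N = 0 -> (n < m)%N -> (f ^+ m) n = 0.
Proof.
move=> f0; elim: m n => // m IHm n; rewrite ltnS => le_nm.
rewrite exprS fpsM big1 // => -[[|i] lt_in] _ /=; first by rewrite f0 mul0r.
have lt_i : (i < n)%N by [].
by rewrite IHm ?mulr0 // (leq_trans _ le_nm) // ltn_subrL /= (leq_ltn_trans _ lt_i).
Qed.

Lemma fps_mulI f g h : f 0%N = 1 -> f * g = f * h -> g = h.
Proof.
move=> f0 efg; apply/eqP; rewrite -subr_eq0; apply/eqP.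
have: f * (g - h) = 0 by rewrite mulrBr efg subrr.
move: (g - h) => e fe0; apply: fpsP => n.
elim/ltn_ind: n => n IHn; have := congr1 (fun x : fps A => x n) fe0.
rewrite fpsM big_ord_recl subn0 f0 mul1r big1 ?addr0 // => i _ /=.
by rewrite IHn ?mulr0 // -subn_gt0 subKn ?bump /=.
Qed.

Lemma fpsM_congr f f' g g' n : (forall i, (i <= n)%N -> f i = f' i) ->
  (forall i, (i <= n)%N -> g i = g' i) -> (f * g) n = (f' * g') n.
Proof.
move=> ff' gg'; rewrite !fpsM; apply: eq_bigr => i _.
by rewrite ff' ?gg' ?leq_subr // -ltnS.
Qed.

Lemma fps_mulV f : f 0%N = 1 -> f * fps_inv f = 1.
Proof.
move=> f0; apply: fpsP => n; pose e := 1 - f.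
have e0 : e 0%N = 0 by rewrite /e fpsB fps1 f0 subrr.
transitivity ((f * \sum_(m < n.+1) e ^+ m) n).
  apply: fpsM_congr => // i le_in; rewrite fps_sumE /fps_inv.
  rewrite (big_ord_widen n.+1 (fun m => fps_exp (fps_sub (fps_one A) f) m i)) //.
  rewrite big_mkcond; apply: eq_bigr => m _; rewrite fps_expE.
  by case: ltnP => // lt_im; rewrite fps_exp_small.
have -> : f = 1 - e by rewrite /e opprB addrC subrK.
by rewrite -opprB mulNr -subrX1 opprB fpsB fps_exp_small // subr0.
Qed.

Lemma fps_inv0 f : f 0%N = 1 -> fps_inv f 0%N = 1.
Proof. by move=> f0; rewrite /fps_inv big_ord1. Qed.

Lemma fps_inv_uniq f g : f 0%N = 1 -> f * g = 1 -> g = fps_inv f.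
Proof. by move=> f0 fg1; apply: (fps_mulI f0); rewrite fg1 fps_mulV. Qed.

Section Composition.
Variable g : fps A.
Hypothesis g0 : g 0%N = 0.

Lemma fps_compE f n N : (n <= N)%N ->
  fps_comp f g n = (\sum_(m < N.+1) fpsC (f m) * g ^+ m) n.
Proof.
move=> le_nN; rewrite fps_sumE /fps_comp.
rewrite (big_ord_widen N.+1 (fun m => f m * fps_exp g m n)) // big_mkcond.
apply: eq_bigr => m _; rewrite fpsC_mul fps_expE.
by case: ltnP => // lt_nm; rewrite fps_exp_small ?mulr0.
Qed.

Lemma fps_compE_horner (p : {poly A}) f n : (forall m, (m <= n)%N -> p`_m = f m) ->
  fps_comp f g n = (map_poly fpsC p).[g] n.
Proof.
move=> pf; have [N [leN le_nN]] : exists N, (size p <= N.+1)%N /\ (n <= N)%N.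
  by exists (maxn n (size p)); rewrite leq_maxl (leq_trans (leq_maxr n _)) // leqnSn.
rewrite (@horner_coef_wide _ N.+1); last by rewrite (leq_trans (size_poly _ _)).
rewrite (fps_compE _ le_nN) !fps_sumE; apply: eq_bigr => i _.
rewrite coef_map /= !fpsC_mul; case: (leqP i n) => [/pf-> //|lt_ni].
by rewrite fps_exp_small ?mulr0.
Qed.

Lemma fps_comp0 f : fps_comp f g 0%N = f 0%N.
Proof. by rewrite /fps_comp big_ord1 mulr1. Qed.

Lemma fps_compD f1 f2 : fps_comp (f1 + f2) g = fps_comp f1 g + fps_comp f2 g.
Proof.
apply: fpsP => n; rewrite fpsD /fps_comp -big_split; apply: eq_bigr => m _.
by rewrite fpsD mulrDl.
Qed.

Lemma fps_compC c : fps_comp (fpsC c) g = fpsC c.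
Proof.
apply: fpsP => -[|n]; rewrite /fps_comp big_ord_recl big1 => [|i _];
  by rewrite ?mul0r ?addr0 ?mulr1 ?mulr0.
Qed.

Lemma fps_compN f : fps_comp (- f) g = - fps_comp f g.
Proof.
apply: fpsP => n; rewrite fpsN /fps_comp -sumrN; apply: eq_bigr => m _.
by rewrite fpsN mulNr.
Qed.

Lemma fps_compB f1 f2 : fps_comp (f1 - f2) g = fps_comp f1 g - fps_comp f2 g.
Proof. by rewrite fps_compD fps_compN. Qed.

Lemma fps_comp1 : fps_comp 1 g = 1.
Proof. by rewrite -(rmorph1 fpsC) fps_compC. Qed.

Lemma fps_compX : fps_comp (fps_X A) g = g.
Proof.
apply: fpsP => n; rewrite (@fps_compE_horner 'X) ?map_polyX ?hornerX //.
by move=> m _; rewrite coefX.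
Qed.

(** Up to a given order composition with g is evaluation of a polynomial at g, and evaluation is multiplicative. *)
Lemma fps_compM f1 f2 : fps_comp (f1 * f2) g = fps_comp f1 g * fps_comp f2 g.
Proof.
apply: fpsP => n; pose t f := fps_trunc n f.
have tE f m : (m <= n)%N -> (t f)`_m = f m by move=> ?; rewrite fps_truncE.
rewrite (@fps_compE_horner (t f1 * t f2)) => [|m le_mn]; last first.
  rewrite coefM fpsM; apply: eq_bigr => i _.
  by rewrite !tE ?(leq_trans (leq_subr _ _)) // (leq_trans _ le_mn) // -ltnS.
rewrite rmorphM hornerM; apply: fpsM_congr => i le_in; symmetry.
  by apply: fps_compE_horner => m le_mi; rewrite tE // (leq_trans le_mi).
by apply: fps_compE_horner => m le_mi; rewrite tE // (leq_trans le_mi).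
Qed.

Lemma fps_comp_prod I (r : seq I) P (F : I -> fps A) :
  fps_comp (\prod_(i <- r | P i) F i) g = \prod_(i <- r | P i) fps_comp (F i) g.
Proof.
elim/big_rec2: _ => [|i x y _ <-]; [exact: fps_comp1 | exact: fps_compM].
Qed.

Lemma fps_comp_sum I (r : seq I) P (F : I -> fps A) :
  fps_comp (\sum_(i <- r | P i) F i) g = \sum_(i <- r | P i) fps_comp (F i) g.
Proof.
elim/big_rec2: _ => [|i x y _ <-]; last exact: fps_compD.
by have := fps_compB 0 0; rewrite !subrr.
Qed.

Lemma fps_comp_inv f : f 0%N = 1 -> fps_comp (fps_inv f) g = fps_inv (fps_comp f g).
Proof.
move=> f0; apply: fps_inv_uniq; first by rewrite fps_comp0.
by rewrite -fps_compM fps_mulV // fps_comp1.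
Qed.

End Composition.

(** The Euler operator t d/dt. *)
Definition fps_D f : fps A := fun n => f n *+ n.

Lemma fps_DE f n : fps_D f n = f n *+ n. Proof. by []. Qed.

Lemma fps_DD f g : fps_D (f + g) = fps_D f + fps_D g.
Proof. by apply: fpsP => n; rewrite fpsD !fps_DE -mulrnDl. Qed.

Lemma fps_DM f g : fps_D (f * g) = fps_D f * g + f * fps_D g.
Proof.
apply: fpsP => n; rewrite fpsD fps_DE !fpsM -sumrMnl -big_split /=.
apply: eq_bigr => i _; rewrite !fps_DE mulrnAl mulrnAr -mulrnDr subnKC //.
by rewrite -ltnS.
Qed.

Lemma fps_DC c : fps_D (fpsC c) = 0.
Proof. by apply: fpsP => -[|n]; rewrite fps_DE ?mul0rn. Qed.

Lemma fps_D1 : fps_D 1 = 0.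
Proof. exact: fps_DC. Qed.

Lemma fps_DX : fps_D (fps_X A) = fps_X A.
Proof. by apply: fpsP => -[|[|n]]; rewrite fps_DE /fps_X //= mul0rn. Qed.

Lemma fps_Dexp f m : fps_D (f ^+ m) = (f ^+ m.-1 * fps_D f) *+ m.
Proof.
elim: m => [|[|m] IHm]; rewrite ?expr0 ?fps_D1 ?expr1 ?mul1r // exprS fps_DM IHm.
by rewrite -mulrnAr mulrA -exprS -mulrnAr mulrC -mulrDr -mulrS.
Qed.

End Ring.

Section Morphism.
Variables (A B : comNzRingType) (phi : {rmorphism A -> B}).
Implicit Types f g : fps A.

Definition map_fps (f : fps A) : fps B := fun n => phi (f n).

Fact map_fps_additive : additive map_fps.
Proof. by move=> f g; apply: fpsP => n; apply: rmorphB. Qed.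
Fact map_fps_multiplicative : multiplicative map_fps.
Proof.
split=> [f g|]; apply: fpsP => n; last by rewrite /map_fps !fps1 rmorph_nat.
by rewrite /map_fps !fpsM rmorph_sum; apply: eq_bigr => i _; rewrite rmorphM.
Qed.
HB.instance Definition _ := GRing.isAdditive.Build (fps A) (fps B) map_fps map_fps_additive.
HB.instance Definition _ :=
  GRing.isMultiplicative.Build (fps A) (fps B) map_fps map_fps_multiplicative.

Lemma map_fpsX : map_fps (fps_X A) = fps_X B.
Proof. by apply: fpsP => n; apply: rmorph_nat. Qed.

Lemma map_fpsC c : map_fps (fpsC c) = fpsC (phi c).
Proof. by apply: fpsP => -[|n] //; apply: rmorph0. Qed.

Lemma map_fps_inv f : f 0%N = 1 -> map_fps (fps_inv f) = fps_inv (map_fps f).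
Proof.
move=> f0; apply: fps_inv_uniq; first by rewrite /map_fps f0 rmorph1.
by rewrite -rmorphM fps_mulV // rmorph1.
Qed.

End Morphism.

(** * The series P_i as the expansion of a shift *)

Lemma fps_comp_id (A : comNzRingType) (f : fps A) : fps_comp f (fps_X A) = f.
Proof.
apply: fpsP => n; rewrite (fps_compE _ f (leqnn n)) // fps_sumE big_ord_recr /= big1.
  by rewrite add0r fpsC_mul -[_ ^+ n]mulr1 fpsMXn leqnn subnn mulr1.
move=> i _; rewrite fpsC_mul -[_ ^+ i]mulr1 fpsMXn (ltnW (ltn_ord i)) fps1.
by rewrite subn_eq0 leqNgt ltn_ord mulr0.
Qed.

Section Formal.
Variables (A : comNzRingType) (R g : fps A).
Hypothesis torsion_free : forall (x : A) n, x *+ n.+1 = 0 -> x = 0.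
Hypothesis R0 : R 0%N = 1.

Local Notation X := (fps_X A).
Local Notation Rv := (fps_inv R).
Local Notation F := (X * Rv).
Local Notation K := (R - fps_D R).

Let Rv0 : Rv 0%N = 1. Proof. exact: fps_inv0. Qed.
Let RRv : R * Rv = 1. Proof. exact: fps_mulV. Qed.
Let F0 : F 0%N = 0. Proof. by rewrite fpsM0 mul0r. Qed.
Let RF : R * F = X. Proof. by rewrite mulrCA RRv mulr1. Qed.
Let K0 : K 0%N = 1. Proof. by rewrite fpsB fps_DE mulr0n subr0 R0. Qed.

(** Change of variable X = F(t) = t / R(t) in a residue.  By linearity f may be
    taken to be X^m; with d = k + 1 - m, the coefficient is that of t^d in
    R^d - R^(d-1) D R, and d times it is the coefficient of t^d in d R^d - D (R^d),
    which is zero.  Only d = 0 contributes. *)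
Lemma jacobi_residue (f : fps A) k :
  (fps_comp f F * (R ^+ k * K)) k.+1 = f k.+1.
Proof.
transitivity (((\sum_(m < k.+2) fpsC (f m) * F ^+ m) * (R ^+ k * K)) k.+1).
  by apply: fpsM_congr => // i le_i; apply: fps_compE.
rewrite mulr_suml fps_sumE big_ord_recr /= -mulrA fpsC_mul.
have FR m : F ^+ m * R ^+ m = X ^+ m by rewrite -exprMn mulrC RF.
have -> : F ^+ k.+1 * (R ^+ k * K) = X ^+ k.+1 * (Rv * K).
  by rewrite exprS -mulrA (mulrA (F ^+ k)) FR exprS !mulrA (mulrAC X).
rewrite fpsMXn leqnn subnn fpsM0 Rv0 K0 !mulr1 big1 ?add0r // => m _.
rewrite -mulrA fpsC_mul.
set d := (k - m)%N; have lemk : (m <= k)%N by rewrite -ltnS.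
have -> : F ^+ m * (R ^+ k * K) = X ^+ m * (R ^+ d * K).
  have -> : R ^+ k = R ^+ m * R ^+ d by rewrite -exprD subnKC.
  by rewrite -mulrA mulrA FR.
rewrite fpsMXn leqW // subSn // -/d [X in _ * X](_ : _ = 0) ?mulr0 //.
apply: (@torsion_free _ d); rewrite mulrBr -exprSr fpsB mulrnBl.
by rewrite -(fps_DE (R ^+ d.+1)) fps_Dexp fpsMn subrr.
Qed.

Lemma fps_D_sum I (r : seq I) P (f : I -> fps A) :
  fps_D (\sum_(i <- r | P i) f i) = \sum_(i <- r | P i) fps_D (f i).
Proof.
by apply: big_morph; [exact: fps_DD | apply: fpsP => i; rewrite fps_DE mul0rn].
Qed.

Lemma D_comp (f h kappa : fps A) : h 0%N = 0 -> fps_D h = h * kappa ->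
  fps_D (fps_comp f h) = fps_comp (fps_D f) h * kappa.
Proof.
move=> h0 Dh; apply: fpsP => n; rewrite fps_DE (fps_compE h0 _ (leqnn n)) -fps_DE.
transitivity (((\sum_(m < n.+1) fpsC (fps_D f m) * h ^+ m) * kappa) n); last first.
  by apply: fpsM_congr => // i le_in; rewrite (fps_compE h0 _ le_in).
rewrite fps_D_sum mulr_suml; congr ((_ : fps A) n); apply: eq_bigr => -[m _] _ /=.
rewrite fps_DM fps_DC mul0r add0r fps_Dexp Dh fps_DE rmorphMn /=.
by case: m => [|m]; rewrite ?mulr0n ?mul0r ?mulr0 //= exprSr mulrA !(mulrnAr, mulrnAl) !mulrA.
Qed.

(** Composed with multiplication by C, this is the operator that produces the
    series P_i; it is t^2 d/dt conjugated by t, up to sign the derivative with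
    respect to z = R(t) / t. *)
Definition Euler_step (f : fps A) : fps A := X * (fps_D f - f).

Lemma D_subst : fps_D F = F * (Rv * K).
Proof.
have DRF : fps_D R * F + R * fps_D F = X by rewrite -fps_DM RF fps_DX.
apply: (fps_mulI R0); apply: (addrI (fps_D R * F)); rewrite DRF.
transitivity (fps_D R * F + (R * Rv) * (R * F - fps_D R * F)); last by ring.
by rewrite RRv mul1r RF addrC subrK.
Qed.

(** The operator C t^2 d/dt in the variable t is X^2 d/dX in the variable
    X = t / R(t); for f = X^a, both sides are (a - 1) R F^(a+1). *)
Lemma Euler_step_comp (C f : fps A) : C * K = 1 ->
  C * Euler_step (R * fps_comp f F) = R * fps_comp (Euler_step f) F.
Proof.
move=> CK; rewrite /Euler_step fps_compM // fps_compX // fps_compB //.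
rewrite fps_DM (@D_comp f F (Rv * K)) //; last exact: D_subst.
set G := fps_comp f F; set G' := fps_comp _ F.
transitivity ((C * K) * X * ((R * Rv) * G' - G)); first by ring.
by rewrite CK RRv (mulrA R) RF !mul1r.
Qed.
End Formal.

(** negbin m i is the coefficient of x^i in (1 - x)^(1 - m). *)
Definition negbin (m i : nat) : int :=
  match m with
  | 0 => if i is i'.+1 then if i' is 0 then -1 else 0 else 1
  | 1 => (i == 0%N)%:R
  | m'.+2 => 'C(m' + i, i)%:R
  end.

Lemma negbin0 m : negbin m 0 = 1.
Proof. by case: m => [|[|m]] //=; rewrite bin0. Qed.

Lemma negbinS m i : negbin m i.+1 *+ i.+1 = negbin m i * ((m + i)%:R - 1).
Proof.
case: m => [|[|m]] /=.
- by case: i => [|i] //; rewrite mul0rn; case: i => [|i]; rewrite ?mul0r.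
- by case: i => [|i]; rewrite ?mul0rn ?mul0r //= mul1r subrr.
- have -> : (m.+2 + i)%:R - 1 = (m + i).+1%:R :> int by rewrite addSn -natr1 addrK addSn.
  by rewrite -[LHS]mulr_natr -!natrM addnS mulnC -mul_bin_diag mulnC.
Qed.

Lemma negbin_pascal m i : negbin m.+1 i.+1 = negbin m i.+1 + negbin m.+1 i.
Proof.
case: m => [|[|m]] /=; first by case: i => [|[|i]].
  by rewrite !add0n !binn add0r.
by rewrite -natrD !addSn addnS binS addnC.
Qed.

Section Shift.
Variables (A : comNzRingType) (j : nat).
Local Notation X := (fps_X A).
Local Notation U := (1 - fpsC j%:R * X).

Let U0 : U 0%N = 1. Proof. by rewrite fpsB fps1 fpsC_mul mulr0 subr0. Qed.

(** Multiplication by 1 - j X lowers the exponent of 1 / (1 - j X), which is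
    Pascal's rule for the coefficients. *)
Lemma fps_inv_exp_negbin m i :
  (U * fps_inv U ^+ m) i = (negbin m i)%:~R * j%:R ^+ i.
Proof.
elim: m i => [|m IHm] i.
  rewrite mulr1 fpsB fpsC_mul fps1; case: i => [|[|i]] /=.
  - by rewrite mulr0 subr0 mulr1.
  - by rewrite mulr1 sub0r expr1 mulN1r.
  - by rewrite mulr0 subr0 mul0r.
have step : U * (U * fps_inv U ^+ m.+1) = U * fps_inv U ^+ m.
  by rewrite exprS (mulrA U (fps_inv U)) fps_mulV // mul1r.
have {step} stepE n : (U * fps_inv U ^+ m.+1) n =
    (U * fps_inv U ^+ m) n + if n is n'.+1 then j%:R * (U * fps_inv U ^+ m.+1) n' else 0.
  rewrite -step; set W := U * _; rewrite mulrBl mul1r fpsB -mulrA fpsC_mul fpsMX.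
  by case: n => [|n]; rewrite ?mulr0 ?subr0 ?addr0 ?subrK.
elim: i => [|i IHi]; rewrite stepE IHm; first by rewrite !negbin0 /= addr0.
by rewrite IHi negbin_pascal intrD mulrDl [in X in _ + X = _]mulrCA -exprS.
Qed.

(** If z g(1/z) is the expansion of G(z), then z (shift g)(1/z) is that of G(z - j). *)
Definition shift (g : fps A) : fps A := U * fps_comp g (X * fps_inv U).

(** The expansion of G(z - j) in powers of j. *)
Lemma shiftE (g : fps A) n N : (n <= N)%N -> shift g n =
  (\sum_(i < N.+1) fpsC (j%:R ^+ i) * (X ^+ i * (fun m => (negbin m i)%:~R * g m))) n.
Proof.
move=> le_nN; have XU0 : (X * fps_inv U) 0%N = 0 by rewrite fpsM0 mul0r.
transitivity ((U * \sum_(m < n.+1) fpsC (g m) * (X * fps_inv U) ^+ m) n).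
  by apply: fpsM_congr => // i le_in; rewrite (fps_compE XU0 _ le_in).
transitivity (\sum_(m < n.+1) g m * ((negbin m (n - m))%:~R * j%:R ^+ (n - m))).
  rewrite mulr_sumr fps_sumE; apply: eq_bigr => m _.
  rewrite mulrCA fpsC_mul exprMn mulrCA fpsMXn fps_inv_exp_negbin.
  by rewrite -ltnS ltn_ord.
pose h i : A := if (i <= n)%N then g (n - i)%N * ((negbin (n - i) i)%:~R * j%:R ^+ i) else 0.
transitivity (\sum_(i < N.+1) h i); last first.
  rewrite fps_sumE; apply: eq_bigr => i _; rewrite fpsC_mul fpsMXn /h.
  by case: leqP => _; [rewrite mulrC -mulrA mulrCA | rewrite mulr0].
transitivity (\sum_(i < n.+1) h i).
  rewrite (reindex_inj rev_ord_inj) /=; apply: eq_bigr => i _.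
  by rewrite /h subSS -ltnS ltn_ord subKn // -ltnS.
rewrite (big_ord_widen N.+1 h) // big_mkcond; apply: eq_bigr => i _.
by rewrite ltnS /h; case: leqP.
Qed.
End Shift.

Section Kerov.
Variables (A : comAlgType rat) (R g : fps A).
Hypotheses (R0 : R 0%N = 1) (R1 : R 1%N = 0).
Local Notation X := (fps_X A).
Local Notation F := (X * fps_inv R).
Hypothesis Rg : R * fps_comp g F = 1.
Local Notation C := (C_series R).
Local Notation K := (R - fps_D R).

Lemma natalg_torsion_free (B : comAlgType rat) (x : B) n : x *+ n.+1 = 0 -> x = 0.
Proof.
move=> xn0; have: (n.+1%:R^-1 : rat) *: (x *+ n.+1) = 0 by rewrite xn0 scaler0.
by rewrite -scaler_nat scalerA mulVf ?scale1r // pnatr_eq0.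
Qed.

Let F0 : F 0%N = 0. Proof. by rewrite fpsM0 mul0r. Qed.

(** R - D R = 1 - \sum_i (i - 1) R_i t^i, as R_0 = 1 and R_1 = 0. *)
Lemma C_seriesK : C * K = 1.
Proof.
rewrite mulrC /C_series; set D := fps_sub _ _.
have -> : K = D.
  apply: fpsP => -[|[|n]]; rewrite fpsB fps_DE /D /fps_sub /fps_add /fps_opp /=.
  - by rewrite R0 subr0.
  - by rewrite R1 mul0rn.
  - by rewrite mulrS opprD addrA subrr.
by apply: fps_mulV; rewrite /D /fps_sub /fps_add /fps_opp /= subr0.
Qed.

(** Starting at P_0 = 1 makes the recursion for the P_i uniform. *)
Definition P_series1 (m : nat) : fps A := if m is 0 then 1 else P_series R m.

Lemma P_series1_step i : (X ^+ i.+1 * P_series1 i.+1) *+ i.+1 = C * Euler_step (X ^+ i * P_series1 i).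
Proof.
case: i => [|i].
  rewrite /Euler_step /P_series1 expr0 expr1 mul1r fps_D1 sub0r mulrN1 mulrN (mulrC C) -mulrN.
  congr (_ * _); apply: fpsP => n.
  by rewrite /P_series /= invr1 scaleNr scale1r fpsN.
transitivity (X ^+ i.+2 * (C * (fps_D (P_series1 i.+1) + P_series1 i.+1 *+ i))); last first.
  rewrite /Euler_step fps_DM fps_Dexp fps_DX -exprSr (exprS X i.+1) mulrS.
  by move: (X ^+ i.+1) (P_series1 i.+1) => Y P; ring.
rewrite -mulrnAr; congr (_ * _); apply: fpsP => n; rewrite fpsMn [RHS]fpsM.
have -> : P_series1 i.+2 n = - ((i.+2)`!%:R^-1 : rat) *: fps_mul C (fps_DI i (PQ_series R i.+1)) n by [].
rewrite /fps_mul -scaler_nat scalerA scaler_sumr; apply: eq_bigr => m _.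
rewrite fpsD fps_DE fpsMn /P_series1 /P_series /fps_DI.
rewrite !scalerMnr -scalerDr -scalerAr; congr (_ *: _).
rewrite factS natrM invfM mulrN mulrA mulfV ?mul1r //.
by rewrite pnatr_eq0.
Qed.

(** The coefficient of j^i in shift j g. *)
Definition shift_term i : fps A := X ^+ i * (fun m => (negbin m i)%:~R * g m).

Lemma shift_term_step i : shift_term i.+1 *+ i.+1 = Euler_step (shift_term i).
Proof.
rewrite /shift_term /Euler_step.
pose h : fps A := fun m => (negbin m i.+1)%:~R * g m.
pose h' : fps A := fun m => (negbin m i)%:~R * g m.
rewrite -/h -/h'; transitivity (X ^+ i.+1 * (h' *+ i + fps_D h' - h')); last first.
  rewrite fps_DM fps_Dexp fps_DX exprS.
  have -> : (X ^+ i.-1 * X) *+ i = X ^+ i *+ i by case: i {h h'} => // i; rewrite -exprSr.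
  by move: (X ^+ i) h' => Y H; ring.
rewrite -mulrnAr; congr (_ * _); apply: fpsP => m.
rewrite fpsB fpsD !fpsMn fps_DE -mulrnDr -[X in _ - X]mulr1 -[X in X - _]mulr_natr.
rewrite -mulrBr /h /h' -mulrnAl -rmorphMn /= negbinS rmorphM rmorphB rmorph1 rmorph_nat.
by rewrite addnC; ring.
Qed.

(** Both sides satisfy the same first-order recursion in i (P_series1_step,
    shift_term_step, Euler_step_comp) and are equal to 1 at i = 0. *)
Lemma P_series1_comp i : X ^+ i * P_series1 i = R * fps_comp (shift_term i) F.
Proof.
elim: i => [|i IHi].
  transitivity (R * fps_comp g F); first by rewrite Rg mulr1.
  congr (_ * fps_comp _ _); apply: fpsP => m.
  by rewrite /shift_term mul1r negbin0 mul1r.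
have tf (x : fps A) n : x *+ n.+1 = 0 -> x = 0.
  move=> xn0; apply: fpsP => m; apply: (@natalg_torsion_free _ _ n).
  by rewrite -fpsMn xn0.
apply/eqP; rewrite -subr_eq0; apply/eqP; apply: (@tf _ i).
rewrite mulrnBl P_series1_step IHi (Euler_step_comp R0 _ C_seriesK) -shift_term_step.
apply/eqP; rewrite subr_eq0 -[X in _ == X]mulrnAr; apply/eqP; congr (_ * _).
move: (shift_term i.+1) => G; move: i.+1 => m; elim: m => [|m IHm];
  last by rewrite !mulrS fps_compD IHm.
by have := fps_compB F 0 0; rewrite !subrr.
Qed.

Lemma P_factor_comp j : P_factor R j = R * fps_comp (shift j g) F.
Proof.
apply: fpsP => n.
have -> : (R * fps_comp (shift j g) F) n =
    (R * fps_comp (\sum_(i < n.+1) fpsC (j%:R ^+ i) * shift_term i) F) n.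
  apply: fpsM_congr => // m le_mn; rewrite /fps_comp; apply: eq_bigr => i _.
  by rewrite (@shiftE _ _ _ i n) // (leq_trans _ le_mn) // -ltnS.
rewrite fps_comp_sum mulr_sumr.
rewrite (eq_bigr (fun i : 'I_n.+1 => fpsC (j%:R ^+ i) * (X ^+ i * P_series1 i))); last first.
  by move=> i _; rewrite fps_compM // fps_compC mulrCA -P_series1_comp.
rewrite /P_factor [LHS]fpsD (fps_sum1E _ (leqnn n)) -fpsD; congr ((_ : fps A) n).
rewrite -(big_mkord xpredT (fun i => fpsC (j%:R ^+ i) * (X ^+ i * P_series1 i))).
rewrite big_ltn // !expr0 rmorph1 !mul1r; congr (_ + _).
apply: eq_big_nat => -[|i] // _.
rewrite mulrCA; congr (_ * _); apply: fpsP => m.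
by rewrite fpsC_mul -natrX mulr_natl.
Qed.

(** The product of the factors is that of R (shift j g)(F); the factor j = 0 is
    R g(F) = 1, and jacobi_residue removes the substitution. *)
Theorem kerov_series_shift k : (0 < k)%N ->
  kerov_series R k k.+1 = (\prod_(j < k) shift j g) k.+1.
Proof.
case: k => // k _; have Cinv : fps_inv C = K.
  have C0 : C 0%N = 1.
    by rewrite /C_series fps_inv0 // /fps_sub /fps_add /fps_opp /= subr0.
  by rewrite -(fps_inv_uniq C0 C_seriesK).
rewrite -[RHS](jacobi_residue (@natalg_torsion_free A) R0) fps_comp_prod //.
rewrite /kerov_series Cinv fps_mulE fps_bigE; congr ((_ : fps A) k.+2).
rewrite mulrC [in RHS]mulrA; congr (_ * _).
have shift0 : shift 0 g = g.
  rewrite /shift (rmorph0 (@fpsC A)) mul0r subr0 mul1r.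
  have -> : fps_inv 1 = 1 :> fps A by rewrite -(@fps_inv_uniq _ 1 1) ?mulr1.
  by rewrite mulr1 fps_comp_id.
rewrite -[X in _ ^+ X]card_ord -prodr_const.
rewrite mulrC -big_split /= big_ord_recl shift0 Rg mul1r big_add1 big_mkord.
by apply: eq_bigr => i _; rewrite P_factor_comp.
Qed.
End Kerov.

(** * Rational profiles and their free cumulants *)

Lemma fps_invM (A : comNzRingType) (f g : fps A) : f 0%N = 1 -> g 0%N = 1 ->
  fps_inv (f * g) = fps_inv f * fps_inv g.
Proof.
move=> f0 g0; rewrite -(@fps_inv_uniq _ (f * g) (fps_inv f * fps_inv g)) //.
  by rewrite fpsM0 f0 g0 mulr1.
by rewrite mulrACA !fps_mulV // mulr1.
Qed.

Lemma fps_invV (A : comNzRingType) (f : fps A) : f 0%N = 1 -> fps_inv (fps_inv f) = f.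
Proof.
move=> f0; rewrite -(@fps_inv_uniq _ (fps_inv f) f) //; first exact: fps_inv0.
by rewrite mulrC fps_mulV.
Qed.

(** Solves equations that give each coefficient in terms of the previous ones;
    iterating Phi stabilises the coefficient of index n after n + 1 steps. *)
Lemma fps_rec (A : Type) (a : A) (Phi : fps A -> fps A) :
  (forall f g n, (forall i, (i < n)%N -> f i = g i) -> Phi f n = Phi g n) ->
  exists f, forall n, Phi f n = f n.
Proof.
move=> loc; pose S := fix S k : fps A := if k is k'.+1 then Phi (S k') else fun _ => a.
have S_stable n k l : (n < k)%N -> (n < l)%N -> S k n = S l n.
  elim/ltn_ind: n k l => n IHn [|k] [|l] // le_nk le_nl.
  apply: loc => i lt_in; exact: IHn (leq_trans lt_in le_nk) (leq_trans lt_in le_nl).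
exists (fun n => S n.+1 n) => n; rewrite -[RHS]/(Phi (S n) n).
by apply: loc => i lt_in; apply: S_stable.
Qed.

Lemma fpsM_low (A : comNzRingType) (e f : fps A) m :
  (forall i, (i < m)%N -> e i = 0) -> (e * f) m = e m * f 0%N.
Proof.
move=> e_low; rewrite fpsM big_ord_recr /= subnn big1 ?add0r // => i _.
by rewrite e_low ?mul0r.
Qed.

Section Profile.
Variables (A : comNzRingType) (L : nat) (u : 'I_L -> A).
Local Notation X := (fps_X A).

Definition lin_factor (c : A) : fps A := 1 - fpsC c * X.

Lemma lin0 c : lin_factor c 0%N = 1. Proof. by rewrite /lin_factor fpsB fpsC_mul mulr0 subr0. Qed.

Lemma comp_lin c h : h 0%N = 0 -> fps_comp (lin_factor c) h = 1 - fpsC c * h.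
Proof. by move=> h0; rewrite fps_compB fps_comp1 fps_compM // fps_compC fps_compX. Qed.

(** z profile_series(1/z) is the expansion of the rational function
    (z + L) \prod_i (z - u_i - 1) / (z - u_i), the inverse of the Cauchy transform
    H when the u_i are the shifted parts of a partition. *)
Definition profile_series : fps A :=
  lin_factor (- L%:R) * \prod_i (lin_factor (u i + 1) * fps_inv (lin_factor (u i))).

(** The relation R g(t / R) = 1 between the cumulants and the profile, with its
    denominators cleared: a polynomial identity in R and t. *)
Definition cumulant_eq (R : fps A) : Prop :=
  (R - fpsC (- L%:R) * X) * \prod_i (R - fpsC (u i + 1) * X) = \prod_i (R - fpsC (u i) * X).

Lemma lin_subst (R : fps A) c : R 0%N = 1 ->
  R - fpsC c * X = R * fps_comp (lin_factor c) (X * fps_inv R).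
Proof.
move=> R0; rewrite comp_lin ?fpsM0 ?mul0r // mulrBr mulr1; congr (_ - _).
by rewrite !(mulrCA R) fps_mulV // mulr1.
Qed.

Lemma fps_cancel_exp (R f g : fps A) n : R 0%N = 1 -> R ^+ n * f = R ^+ n * g -> f = g.
Proof. by move=> R0; apply: fps_mulI; rewrite fpsX0 R0 expr1n. Qed.

Lemma profile_series_comp (R : fps A) : R 0%N = 1 -> cumulant_eq R ->
  R * fps_comp profile_series (X * fps_inv R) = 1.
Proof.
move=> R0; have F0 : (X * fps_inv R) 0%N = 0 by rewrite fpsM0 mul0r.
rewrite /cumulant_eq (lin_subst _ R0).
under eq_bigr do rewrite (lin_subst _ R0).
under [RHS]eq_bigr do rewrite (lin_subst _ R0).
rewrite !big_split prodr_const mulrCA => /(fps_cancel_exp R0) eR.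
rewrite fps_compM // fps_comp_prod //.
under eq_bigr do rewrite fps_compM // fps_comp_inv ?lin0 //.
rewrite big_split /= !mulrA eR -big_split big1 // => i _ /=.
by rewrite fps_mulV // fps_comp0 // lin0.
Qed.

Lemma shift_profile_series j : shift j profile_series =
  lin_factor (j%:R - L%:R) * \prod_i (lin_factor (u i + j.+1%:R) * fps_inv (lin_factor (u i + j%:R))).
Proof.
rewrite /shift -/(lin_factor j%:R); set U := lin_factor _; have U0 : U 0%N = 1 := lin0 _.
have y0 : (X * fps_inv U) 0%N = 0 by rewrite fpsM0 mul0r.
have linE c : fps_comp (lin_factor c) (X * fps_inv U) = fps_inv U * lin_factor (c + j%:R).
  rewrite comp_lin //; set V := fps_inv U.
  transitivity (V * U - fpsC c * (X * V)); first by rewrite (mulrC V) fps_mulV.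
  by rewrite /U /lin_factor rmorphD /=; ring.
rewrite fps_compM // fps_comp_prod // linE !mulrA fps_mulV // mul1r addrC.
congr (_ * _); apply: eq_bigr => i _.
rewrite fps_compM // fps_comp_inv ?lin0 // !linE fps_invM ?lin0 ?fps_inv0 //.
rewrite fps_invV // mulrACA (mulrC _ U) fps_mulV // mul1r -addrA.
by rewrite [1 + _]addrC natr1.
Qed.

(** The factors of the rational function indexed by i telescope. *)
Lemma prod_shift_profile_series k : \prod_(j < k) shift j profile_series =
  \prod_(j < k) lin_factor (j%:R - L%:R) * \prod_i (lin_factor (u i + k%:R) * fps_inv (lin_factor (u i))).
Proof.
elim: k => [|k IHk].
  by rewrite !big_ord0 mul1r big1 // => i _; rewrite addr0 fps_mulV ?lin0.
rewrite !big_ord_recr /= IHk shift_profile_series mulrACA; congr (_ * _).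
rewrite -big_split; apply: eq_bigr => i _ /=.
transitivity ((lin_factor (u i + k%:R) * fps_inv (lin_factor (u i + k%:R))) *
  (lin_factor (u i + k.+1%:R) * fps_inv (lin_factor (u i)))); first by ring.
by rewrite fps_mulV ?lin0 // mul1r.
Qed.

(** All the factors have constant term 1, so that a change of the coefficient of
    index m in R changes that of the product by the number of factors times as much. *)
Lemma prod_lin_diff (R R' : fps A) (s : seq A) m : (0 < m)%N -> R 0%N = 1 ->
  (forall i, (i < m)%N -> R i = R' i) ->
  (forall i, (i < m)%N ->
    (\prod_(c <- s) (R - fpsC c * X)) i = (\prod_(c <- s) (R' - fpsC c * X)) i) /\
  (\prod_(c <- s) (R - fpsC c * X)) m =
    (\prod_(c <- s) (R' - fpsC c * X)) m + (R m - R' m) *+ size s.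
Proof.
move=> m0 R0 eqR; have R'0 : R' 0%N = 1 by rewrite -eqR.
have E0 (f : fps A) c : f 0%N = 1 -> (f - fpsC c * X) 0%N = 1.
  by move=> f0; rewrite fpsB fpsC_mul mulr0 subr0.
elim: s => [|c s [IHlt IHm]]; first by rewrite !big_nil addr0.
have eqC i : (i < m)%N -> (R - fpsC c * X) i = (R' - fpsC c * X) i.
  by move=> lt_im; rewrite !fpsB eqR.
rewrite !big_cons; split=> [i lt_im|].
  apply: fpsM_congr => l le_li; [apply: eqC|apply: IHlt]; exact: leq_ltn_trans lt_im.
set P := R - _ in eqC *; set P' := R' - _ in eqC *; set Q := \prod_(_ <- _) _ in IHm IHlt *.
set Q' := \prod_(_ <- _) (R' - _) in IHm IHlt *.
have -> : P * Q = P' * Q' + ((P - P') * Q + (Q - Q') * P') by ring.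
rewrite 2!fpsD (@fpsM_low _ (P - P')) => [|i lt_im]; last by rewrite fpsB eqC ?subrr.
rewrite (@fpsM_low _ (Q - Q')) => [|i lt_im]; last by rewrite fpsB IHlt ?subrr.
have Q0 : Q 0%N = 1 by rewrite /Q fps_prod0 big1 // => c' _; apply: E0.
rewrite Q0 [P' 0%N]E0 // !mulr1 (fpsB Q) IHm mulrS /P /P' !fpsB; ring.
Qed.

Definition cumulant_defect (R : fps A) : fps A :=
  (R - fpsC (- L%:R) * X) * \prod_i (R - fpsC (u i + 1) * X) - \prod_i (R - fpsC (u i) * X).

(** There is one more factor on the left of cumulant_eq than on its right, so the
    defect determines the coefficients of R one after the other. *)
Lemma cumulant_defect_lead (R R' : fps A) m : (0 < m)%N -> R 0%N = 1 ->
  (forall i, (i < m)%N -> R i = R' i) ->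
  cumulant_defect R m - cumulant_defect R' m = R m - R' m.
Proof.
move=> m0 R0 eqR.
have seqE (f : fps A) : cumulant_defect f =
    \prod_(c <- - L%:R :: [seq u i + 1 | i <- enum 'I_L]) (f - fpsC c * X)
    - \prod_(c <- [seq u i | i <- enum 'I_L]) (f - fpsC c * X).
  by rewrite big_cons !big_map.
have szE (T : Type) (f : 'I_L -> T) : size [seq f i | i <- enum 'I_L] = L.
  by rewrite size_map size_enum_ord.
rewrite !seqE ![(_ - _ : fps A) m]fpsB.
have [_ ->] := prod_lin_diff (- L%:R :: [seq u i + 1 | i <- enum 'I_L]) m0 R0 eqR.
have [_ ->] := prod_lin_diff [seq u i | i <- enum 'I_L] m0 R0 eqR.
by rewrite /= !szE mulrS; ring.
Qed.

Lemma cumulant_defect0 (R : fps A) : R 0%N = 1 -> cumulant_defect R 0%N = 0.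
Proof.
move=> R0; rewrite /cumulant_defect fpsB fpsM0 !fps_prod0 fpsB fpsC_mul mulr0 subr0 R0 mul1r.
by rewrite !big1 ?subrr // => i _; rewrite fpsB fpsC_mul mulr0 subr0.
Qed.

Lemma cumulant_exists : exists2 R : fps A, R 0%N = 1 & cumulant_eq R.
Proof.
(* The first coefficient is forced to be 1, as cumulant_defect_lead needs. *)
pose nz (f : fps A) : fps A := fun n => if n is 0 then 1 else f n.
pose Phi (f : fps A) : fps A := fun n => if n is 0 then 1 else f n - cumulant_defect (nz f) n.
have [|R RE] := @fps_rec A 0 Phi.
  move=> f g [|n] // fg; rewrite /Phi -[f _]/(nz f n.+1) -[g _]/(nz g n.+1).
  have nz_fg i : (i < n.+1)%N -> nz f i = nz g i by case: i => // i; apply: fg.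
  have d := @cumulant_defect_lead (nz f) (nz g) n.+1 isT erefl nz_fg.
  by apply/eqP; rewrite subr_eq addrAC -addrA d addrC subrK.
have R0 : R 0%N = 1 by rewrite -RE.
have nzR : nz R = R by apply: fpsP => -[|n].
exists R => //; apply/eqP; rewrite -subr_eq0; apply/eqP; apply: fpsP => -[|n].
  exact: cumulant_defect0.
have := RE n.+1; rewrite /Phi nzR => /eqP; rewrite subr_eq addrC -subr_eq subrr eq_sym.
by move/eqP.
Qed.

Lemma cumulant_unique (R R' : fps A) N : R 0%N = 1 -> R' 0%N = 1 ->
  (forall m, (m <= N)%N -> cumulant_defect R m = cumulant_defect R' m) ->
  forall m, (m <= N)%N -> R m = R' m.
Proof.
move=> R0 R'0 eq_d; elim/ltn_ind => -[|m] IHm le_mN; first by rewrite R0.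
apply/eqP; rewrite -subr_eq0 -(@cumulant_defect_lead R R' m.+1) ?eq_d ?subrr //.
by move=> i lt_im; apply: IHm; rewrite ?(leq_trans (ltnW lt_im)).
Qed.

Lemma fpsM1 (f g : fps A) : (f * g) 1%N = f 0%N * g 1%N + f 1%N * g 0%N.
Proof. by rewrite fpsM big_ord_recl big_ord1. Qed.

Lemma cumulant1 (R : fps A) : R 0%N = 1 -> cumulant_eq R -> R 1%N = 0.
Proof.
move=> R0 eqR; have d0 : cumulant_defect R 1%N = 0.
  by rewrite /cumulant_defect eqR subrr.
have := @cumulant_defect_lead R 1 1 isT R0; rewrite d0 fps1 subr0 => <-; last first.
  by case.
have lin1 c : (1 - fpsC c * X) 1%N = - c.
  by rewrite fpsB fpsC_mul fps1 sub0r mulr1.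
have prod1 (f : 'I_L -> A) : (\prod_i (1 - fpsC (f i) * X)) 1%N = - \sum_i f i.
  rewrite -sumrN; pose S (a : fps A) (b : A) := a 0%N = 1 /\ a 1%N = b.
  suff: S (\prod_i (1 - fpsC (f i) * X)) (\sum_i - f i) by case.
  apply: (big_ind2 S); first by split; rewrite ?fps1.
    move=> a x b y [a0 a1] [b0 b1]; split; first by rewrite fpsM0 a0 b0 mulr1.
    by rewrite fpsM1 a0 a1 b0 b1 mul1r mulr1 addrC.
  by move=> i _; split; [exact: lin0 | exact: lin1].
have prod0 (f : 'I_L -> A) : (\prod_i (1 - fpsC (f i) * X)) 0%N = 1.
  by rewrite fps_prod0 big1 // => i _; apply: lin0.
rewrite /cumulant_defect fpsB fpsM1 !prod1 prod0 lin1 [X in X * _]lin0 big_split /= sumr_const card_ord.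
by rewrite opprK; ring.
Qed.
End Profile.

(** * Every sequence of free cumulants comes from a profile *)

Section Homogenize.
Variable A : comNzRingType.
Local Notation X := (fps_X A).

(** X^n p(Y / X), written without denominators. *)
Definition homogenize (p : {poly A}) n (Y : fps A) : fps A :=
  \sum_(i < n.+1) fpsC p`_(n - i) * X ^+ i * Y ^+ (n - i).

Lemma prod_homogenize (s : seq A) (Y : fps A) :
  \prod_(c <- s) (Y - fpsC c * X) = homogenize (\prod_(c <- s) ('X - c%:P)) (size s) Y.
Proof.
elim: s => [|c s IHs].
  by rewrite /homogenize !big_nil big_ord1 coef1 rmorph1 !mulr1.
rewrite !big_cons IHs /homogenize /=; set p := \prod_(_ <- _) _; set n := size s.
have szp : size p = n.+1 by rewrite /p size_prod_XsubC.
rewrite mulrBl mulr_sumr mulr_sumr.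
transitivity (\sum_(i < n.+2) (fpsC (('X * p)`_(n.+1 - i)) * X ^+ i * Y ^+ (n.+1 - i))
  - \sum_(i < n.+2) (fpsC c * fpsC (p`_(n.+1 - i)) * X ^+ i * Y ^+ (n.+1 - i))).
  congr (_ - _).
    rewrite [in RHS]big_ord_recr /= subnn coefXM rmorph0 !mul0r addr0; apply: eq_bigr => i _.
    rewrite coefXM subSn -1?ltnS //= exprS; ring.
  rewrite [in RHS]big_ord_recl subn0 nth_default ?szp // rmorph0 mulr0 !mul0r add0r.
  apply: eq_bigr => i _; rewrite /bump /= subSS exprS; ring.
rewrite -sumrB; apply: eq_bigr => i _; rewrite mulrBl coefB mulrC coefCM.
by rewrite rmorphB rmorphM /=; ring.
Qed.
End Homogenize.

Section Surjective.
Variables (F : closedFieldType) (char0 : forall n, n.+1%:R != 0 :> F).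
Local Notation X := (fps_X F).

(** Write \prod_i (x - u_i) = \sum_i q_i x^(k-i).  The coefficient of t^(m+1) in
    the defect is m q_m plus a combination of the q_i with i < m, so the q_m can
    be chosen one after the other to cancel it.  The u_i are the roots of the
    polynomial obtained. *)
Lemma cumulant_surjective k (R : fps F) : R 0%N = 1 -> R 1%N = 0 ->
  exists u : 'I_k -> F, forall m, (m <= k.+1)%N -> cumulant_defect u R m = 0.
Proof.
move=> R0 R1; pose B i : fps F := (R + fpsC k%:R * X) * (R - X) ^+ (k - i) - R ^+ (k - i).
have B0 i : B i 0%N = 0.
  by rewrite /B fpsB fpsM0 !fpsX0 fpsD fpsB fpsC_mul mulr0 subr0 addr0 R0 !expr1n mul1r subrr.
have exp1 (f : fps F) n : f 0%N = 1 -> (f ^+ n) 1%N = f 1%N *+ n.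
  move=> f0; elim: n => [|n IHn]; first by rewrite expr0 fps1.
  by rewrite exprS fpsM1 f0 IHn fpsX0 f0 expr1n mul1r mulr1 mulrSr.
have B1 i : (i <= k)%N -> B i 1%N = i%:R.
  move=> le_ik; rewrite /B fpsB fpsM1 !exp1 ?fpsX0 ?fpsB ?fpsD ?fpsC_mul ?R0 ?R1 ?mulr0 ?addr0 ?subr0 //.
  rewrite expr1n mulr1 mul1r mul0rn subr0 sub0r add0r mulr1 mulNrn.
  by rewrite addrC -natrB ?leq_subr // subKn.
pose Phi (q : fps F) : fps F := fun m => if m is m'.+1
  then - (\sum_(i < m'.+1) q i * B i (m'.+2 - i)%N) / m'.+1%:R else 1.
have [|q qE] := @fps_rec F 0 Phi.
  move=> f g [|n] // fg; rewrite /Phi; congr (- _ / _).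
  by apply: eq_bigr => i _; rewrite fg.
pose p : {poly F} := \poly_(j < k.+1) q (k - j)%N.
have q0 : q 0%N = 1 by rewrite -qE.
have pk : p`_k = 1 by rewrite coef_poly leqnn subnn.
have szp : size p = k.+1.
  apply/anti_leq; rewrite size_poly ltnNge; apply/negP => /leq_sizeP/(_ k (leqnn k)).
  by rewrite pk; apply/eqP; rewrite oner_eq0.
have [s ps] := closed_field_poly_normal p.
have {}ps : p = \prod_(z <- s) ('X - z%:P) by rewrite {1}ps lead_coefE szp pk scale1r.
have szs : size s = k by apply: succn_inj; rewrite -szp ps size_prod_XsubC.
have pq i : (i <= k)%N -> p`_(k - i) = q i.
  by move=> le_ik; rewrite coef_poly ltnS leq_subr subKn.
exists (fun i => s`_i) => m le_mk.
have prodE (Y : fps F) (a : F) :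
    \prod_(i < k) (Y - fpsC (s`_i + a) * X) = homogenize p k (Y - fpsC a * X).
  rewrite -szs ps -prod_homogenize szs (big_nth 0) szs big_mkord.
  by apply: eq_bigr => i _; rewrite rmorphD /=; ring.
have -> : cumulant_defect (fun i : 'I_k => s`_i) R = \sum_(i < k.+1) fpsC (q i) * (X ^+ i * B i).
  rewrite /cumulant_defect prodE.
  under [X in _ - X]eq_bigr do rewrite -[s`_ _]addr0.
  rewrite prodE rmorph1 rmorph0 mul1r mul0r subr0 rmorphN mulNr opprK /homogenize.
  rewrite mulr_sumr -sumrB; apply: eq_bigr => i _.
  by rewrite pq -1?ltnS // /B; ring.
rewrite fps_sumE.
under eq_bigr do rewrite fpsC_mul fpsMXn.
case: m le_mk => [|m le_mk].
  by move=> _; rewrite big1 // => i _; case: ifP => _; rewrite ?mulr0 // sub0n B0 mulr0.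
pose h i : F := q i * (if (i <= m.+1)%N then B i (m.+1 - i)%N else 0).
rewrite -[LHS]/(\sum_(i < k.+1) h i).
transitivity (\sum_(i < m.+1) h i).
  rewrite [RHS](big_ord_widen k.+1 h) // [RHS]big_mkcond; apply: eq_bigr => i _ /=.
  case: ifP => //; rewrite ltnNge => /negbFE lt_mi; rewrite /h.
  case: ifP => [le_im|]; rewrite ?mulr0 //.
  have -> : nat_of_ord i = m.+1 by apply/anti_leq; rewrite le_im.
  by rewrite subnn B0 mulr0.
rewrite big_ord_recr /= /h leqnSn subSn // subnn B1 //.
case: m le_mk {h} => [|m] le_mk.
  by rewrite big_ord0 mulr0 addr0.
rewrite -[q m.+1]qE /= divfK // addrC.
apply/eqP; rewrite addrC subr_eq0; apply/eqP; apply: eq_bigr => i _.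
by rewrite leqW // ltnW // ltnS ltnW.
Qed.
End Surjective.

(** * Polynomials vanishing at strict partitions, and residues *)

Lemma rmorph_mmap (n : nat) (R S T : comNzRingType) (f : R -> S) (phi : {rmorphism S -> T})
    (h : 'I_n -> S) (p : {mpoly R[n]}) :
  phi (mmap f h p) = mmap (phi \o f) (phi \o h) p.
Proof.
rewrite /mmap rmorph_sum; apply: eq_bigr => m _.
by rewrite rmorphM /mmap1 rmorph_prod; congr (_ * _); apply: eq_bigr => i _; rewrite rmorphXn.
Qed.

Lemma eq_mmap (n : nat) (R S : nzRingType) (f f' : R -> S) (h h' : 'I_n -> S) p :
  f =1 f' -> h =1 h' -> mmap f h p = mmap f' h' p.
Proof.
move=> ff hh; apply: eq_bigr => m _; rewrite ff; congr (_ * _).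
by apply: eq_bigr => i _; rewrite hh.
Qed.

Lemma poly_eq0_of_nat_roots (B : idomainType) (q : {poly B}) (b : B) :
  (forall n, n.+1%:R != 0 :> B) -> (forall t, q.[t%:R + b] = 0) -> q = 0.
Proof.
move=> char0 q0; apply/eqP/negPn/negP => nz_q.
have inj : injective (fun t : nat => t%:R + b : B).
  move=> s t /addIr /eqP; wlog le_st : s t / (s <= t)%N.
    by move=> wl; case/orP: (leq_total s t) => [|le] eq_st; [apply: wl | symmetry; apply: wl;
      rewrite // eq_sym].
  rewrite eq_sym -subr_eq0 -natrB //; case def: (t - s)%N => [|d];
    last by rewrite (negPf (char0 d)).
  by move=> _; apply/anti_leq; rewrite le_st -subn_eq0 def.
pose rs := [seq t%:R + b | t <- iota 0 (size q)].
have: (size rs < size q)%N.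
  apply: max_poly_roots => //; last by rewrite map_inj_uniq // iota_uniq.
  by apply/allP => _ /mapP[t _ ->]; apply/eqP.
by rewrite size_map size_iota ltnn.
Qed.

(** One variable at a time, from the first: a polynomial that vanishes for all
    large values of one coordinate, the next ones being fixed, vanishes
    identically in it, so the coordinate may be replaced by an indeterminate. *)
Lemma mpoly_eq0_of_strict L (p : {mpoly rat[L]}) :
  (forall w : 'I_L -> nat, (forall i j : 'I_L, (i < j)%N -> (w j < w i)%N) ->
     (forall i, 0 < w i)%N -> p.@[fun i => (w i)%:R - i.+1%:R] = 0) -> p = 0.
Proof.
move=> p0; pose B : idomainType := {mpoly rat[L]}.
have charB n : n.+1%:R != 0 :> B by rewrite -mpolyC_nat mpolyC_eq0 pnatr_eq0.
suff claim m (w : 'I_L -> nat) : (m <= L)%N ->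
    (forall i j : 'I_L, (i < j)%N -> (w j < w i)%N) -> (forall i, 0 < w i)%N ->
    mmap (@mpolyC L rat) (fun i : 'I_L => if (i < m)%N then 'X_i
       else (w i)%:R - i.+1%:R : B) p = 0.
  rewrite -[RHS](claim L (fun i => L - i)%N) // => [|i j lt_ij|i]; last 2 first.
  - by rewrite ltn_sub2l // ltn_ord.
  - by rewrite subn_gt0.
  rewrite -[LHS]comp_mpoly_id; apply: eq_mmap => i //=.
  by rewrite ltn_ord tnth_mktuple.
elim: m w => [|m IHm] w le_mL w_lt w_gt0.
  rewrite -[RHS](rmorph0 (@mpolyC L rat)) -(p0 w w_lt w_gt0) [RHS]rmorph_mmap.
  by apply: eq_mmap => i //=; rewrite rmorphB /= !rmorph_nat.
pose q : {poly B} := mmap (@polyC B \o @mpolyC L rat) (fun i : 'I_L =>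
  if (i < m)%N then ('X_i : B)%:P else if i == m :> nat then 'X else ((w i)%:R - i.+1%:R : B)%:P) p.
have q_eval c : q.[c] = mmap (@mpolyC L rat) (fun i : 'I_L => if (i < m)%N then 'X_i
    else if i == m :> nat then c else (w i)%:R - i.+1%:R : B) p.
  rewrite -[LHS]/(horner_eval c q) [LHS]rmorph_mmap; apply: eq_mmap => i /=;
    rewrite /horner_eval ?hornerC //.
  by case: ifP => _; rewrite ?hornerC //; case: ifP => _; rewrite ?hornerC ?hornerX.
pose om := Ordinal le_mL.
have q_eq0 : q = 0.
  apply: (@poly_eq0_of_nat_roots _ _ ((w om)%:R - m.+1%:R)) => // t.
  (* Decreasing and large up to m, and equal to w beyond. *)
  pose w' (i : 'I_L) := if (i <= m)%N then (w om + t + (m - i))%N else w i.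
  rewrite q_eval -[RHS](IHm w') ?(ltnW le_mL) // => [|i j lt_ij|i]; last 2 first.
  - rewrite /w'; case: (leqP j m) => [le_jm|lt_mj].
      by rewrite (leq_trans (ltnW lt_ij) le_jm) ltn_add2l ltn_sub2l // (leq_trans lt_ij).
    case: (leqP i m) => _; last exact: w_lt.
    by rewrite -addnA ltn_addr // w_lt.
  - by rewrite /w'; case: (leqP i m) => _ //; rewrite -addnA addn_gt0 w_gt0.
  apply: eq_mmap => i //; case: ltngtP => [lt_im|lt_mi|eq_im] //; rewrite /w'.
    by rewrite leqNgt lt_mi.
  by rewrite eq_im leqnn subnn addn0 natrD addrA [_%:R + _]addrC.
rewrite -(horner0 'X_om) -q_eq0 q_eval; apply: eq_mmap => i //.
rewrite ltnS; case: ltngtP => // eq_im; congr mpolyX; congr mnm1; exact: val_inj.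
Qed.

Section Geometric.
Variable F : comNzRingType.
Local Notation X := (fps_X F).

Definition geom (a : F) : fps F := fun n => a ^+ n.

Lemma geomK a : lin_factor a * geom a = 1.
Proof.
apply: fpsP => n; rewrite /lin_factor mulrBl mul1r fpsB -mulrA fpsC_mul fpsMX fps1.
by case: n => [|n]; rewrite /geom ?mulr0 ?subr0 // -exprS subrr.
Qed.

(** Once m is at least the degree of the product, the coefficients of its
    multiple by 1 / (1 - a X) are geometric. *)
Lemma prod_lin_geom (s : seq F) a m : (size s <= m)%N ->
  (\prod_(c <- s) lin_factor c * geom a) m = a ^+ (m - size s) * \prod_(c <- s) (a - c).
Proof.
elim: s m => [|c s IHs] m le_sm; first by rewrite !big_nil mul1r mulr1 subn0.
case: m le_sm => // m le_sm.
rewrite !big_cons; set P := \prod_(_ <- _) _ in IHs *.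
have -> : lin_factor c * P * geom a = P * geom a - fpsC c * (X * (P * geom a)).
  by rewrite /lin_factor; move: (geom a) (fpsC c) => G C; ring.
rewrite fpsB fpsC_mul fpsMX (IHs m.+1 (ltnW le_sm)) (IHs m le_sm) /= subSn // subSS exprS.
by ring.
Qed.

End Geometric.

Section Residue.
Variables (F : fieldType) (L : nat) (u : 'I_L -> F).
Hypothesis u_inj : injective u.
Local Notation X := (fps_X F).

Local Notation d i := (\prod_(j | j != i) (u i - u j))^-1.

Lemma d_neq0 i : \prod_(j | j != i) (u i - u j) != 0.
Proof. by apply/prodf_neq0 => j; rewrite subr_eq0 (inj_eq u_inj) eq_sym. Qed.

(** The coefficient of x^(L-1) in the Lagrange interpolation of x^m. *)
Lemma lagrange_moment m : (m < L)%N -> \sum_i d i * u i ^+ m = (m == L.-1)%:R.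
Proof.
move=> lt_mL; pose p : {poly F} := \sum_i (d i * u i ^+ m) *: \prod_(j | j != i) ('X - (u j)%:P) - 'X^m.
have szprod i : size (\prod_(j | j != i) ('X - (u j)%:P)) = L.
  rewrite -big_filter size_prod_XsubC -[RHS]card_ord (cardD1 i) inE add1n; congr _.+1.
  rewrite -sum1_card -sum1_size big_filter; apply: eq_bigl => j; by rewrite !inE andbT.
have szp : (size p <= L)%N.
  rewrite (leq_trans (size_polyD _ _)) // geq_max size_polyN size_polyXn lt_mL andbT.
  rewrite (leq_trans (size_sum _ _ _)) //; apply/bigmax_leqP => i _.
  by rewrite (leq_trans (size_scale_leq _ _)) // szprod.
have p_root i : p.[u i] = 0.
  rewrite hornerD hornerN hornerXn horner_sum (bigD1 i) //= [X in _ + X - _]big1 ?addr0 => [|j ne_ji].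
    rewrite hornerZ.
    have -> : (\prod_(j | j != i) ('X - (u j)%:P)).[u i] = \prod_(j | j != i) (u i - u j).
      by rewrite horner_prod; apply: eq_bigr => j _; rewrite hornerXsubC.
    by rewrite mulrAC mulVf ?d_neq0 // mul1r subrr.
  rewrite hornerZ horner_prod [X in _ * X](bigD1 i) 1?eq_sym //=.
  by rewrite hornerXsubC subrr mul0r mulr0.
have p0 : p = 0.
  apply: (@roots_geq_poly_eq0 _ p [seq u i | i <- enum 'I_L]).
  - by apply/allP => _ /mapP[i _ ->]; apply/eqP.
  - by rewrite map_inj_uniq ?enum_uniq.
  - by rewrite size_map size_enum_ord.
have := congr1 (fun q : {poly F} => q`_L.-1) p0; rewrite /p coefB coef0 coefXn coef_sum => /eqP.
rewrite subr_eq0 [L.-1 == m]eq_sym => /eqP <-; apply: eq_bigr => i _.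
rewrite coefZ; set Q := \prod_(j | _) ('X - _); have -> : Q`_L.-1 = lead_coef Q.
  by rewrite lead_coefE szprod.
suff -> : lead_coef Q = 1 by rewrite mulr1.
by rewrite lead_coef_prod big1 // => j _; apply: lead_coefXsubC.
Qed.

(** The series S = \sum_i d_i / (1 - u_i X), with d_i the inverse of
    \prod_(j != i) (u_i - u_j), is the partial fraction decomposition of
    X^(L-1) / \prod_i (1 - u_i X): the product of S by the denominator has the
    right coefficients below L by lagrange_moment and none from L on by
    prod_lin_geom. *)
Lemma residue_sum (s : seq F) N : (0 < L)%N -> (N + L = (size s).+1)%N ->
  (\prod_(c <- s) lin_factor c * \prod_i fps_inv (lin_factor (u i))) N =
  \sum_i \prod_(c <- s) (u i - c) / \prod_(j | j != i) (u i - u j).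
Proof.
case: L u u_inj d_neq0 lagrange_moment => // L' v v_inj dn0 lagr _; rewrite addnS => -[sz].
pose S : fps F := \sum_i fpsC (\prod_(j | j != i) (v i - v j))^-1 * geom (v i).
have PS : \prod_i lin_factor (v i) * S = X ^+ L'.
  apply: fpsP => n; case: (leqP n L') => [le_nL|lt_Ln].
    rewrite mulrC -[X ^+ L']mulr1 fpsMXn.
    transitivity ((X ^+ L' * \prod_i lin_factor (v i)) n).
      apply: fpsM_congr => // i le_in; rewrite /S fps_sumE.
      under eq_bigr do rewrite fpsC_mul.
      rewrite lagr ?ltnS ?(leq_trans le_in) // -[X ^+ L']mulr1 fpsMXn fps1 subn_eq0.
      by case: ltngtP (leq_trans le_in le_nL).
    rewrite fpsMXn; case: ltngtP le_nL => // -> _; rewrite subnn fps_prod0 big1 // => i _;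
      exact: lin0.
  rewrite /S mulr_sumr fps_sumE -[X ^+ L']mulr1 fpsMXn ltnW // fps1 subn_eq0 leqNgt lt_Ln big1 // => i _.
  rewrite mulrCA fpsC_mul -(big_map v xpredT (@lin_factor F)) prod_lin_geom; last first.
    by rewrite size_map /index_enum; case: index_enum_key => /=; rewrite -enumT size_enum_ord.
  rewrite big_map [X in _ * (_ * X)](bigD1 i) //= subrr mul0r !mulr0 //.
have -> : (\prod_(c <- s) lin_factor c * \prod_i fps_inv (lin_factor (v i))) N =
    (\prod_(c <- s) lin_factor c * S) (N + L')%N.
  have -> : S = X ^+ L' * \prod_i fps_inv (lin_factor (v i)).
    rewrite -PS mulrAC -big_split /= big1 ?mul1r // => i _.
    by rewrite fps_mulV // lin0.
  by rewrite mulrCA fpsMXn leq_addl addnK.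
rewrite /S mulr_sumr fps_sumE; apply: eq_bigr => i _.
by rewrite mulrCA fpsC_mul prod_lin_geom sz // subnn mul1r mulrC.
Qed.
End Residue.

(** * Words of given content and permutation characters *)

Section Words.
Variable T : finType.

Definition occ n (F : {ffun 'I_n -> T}) t : nat := \sum_x (F x == t).

Lemma occE n (F : {ffun 'I_n -> T}) t : occ F t = #|[set x | F x == t]|.
Proof. by rewrite -sum1dep_card big_mkcond. Qed.

Lemma sum_occ n (F : {ffun 'I_n -> T}) : (\sum_t occ F t = n)%N.
Proof.
rewrite exchange_big -[RHS]card_ord -sum1_card; apply: eq_bigr => x _ /=.
by rewrite (bigD1 (F x)) //= eqxx big1 // => t; rewrite eq_sym => /negPf->.
Qed.

Definition const_on k n (F : {ffun 'I_n -> T}) :=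
  [forall x : 'I_n, forall y : 'I_n, (x < k)%N && (y < k)%N ==> (F x == F y)].

Definition prepend k m t (F : {ffun 'I_m -> T}) : {ffun 'I_(k + m) -> T} :=
  [ffun x => if split x is inr y then F y else t].

Lemma prependL k m t (F : {ffun 'I_m -> T}) x : prepend k t F (lshift m x : 'I_(k + m)) = t.
Proof. by rewrite ffunE -/(unsplit (inl x)) unsplitK. Qed.
Lemma prependR k m t (F : {ffun 'I_m -> T}) x : prepend k t F (rshift k x) = F x.
Proof. by rewrite ffunE -/(unsplit (inr x)) unsplitK. Qed.

Lemma occ_prepend k m t (F : {ffun 'I_m -> T}) t' :
  occ (prepend k t F : {ffun 'I_(k + m) -> T}) t' = (occ F t' + k * (t == t'))%N.
Proof.
rewrite /occ big_split_ord /= [RHS]addnC; congr (_ + _)%N.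
  by under eq_bigr do rewrite prependL; rewrite sum_nat_const card_ord.
by apply: eq_bigr => x _; rewrite prependR.
Qed.

(** A word constant on its first k + 1 letters is given by that letter and the
    remaining word. *)
Lemma card_const_on k m (a : T -> nat) :
  #|[set F : {ffun 'I_(k.+1 + m) -> T} | const_on k.+1 F & [forall t, occ F t == a t]]| =
  (\sum_t #|[set F : {ffun 'I_m -> T} |
       [forall t', occ F t' + k.+1 * (t == t') == a t']]|)%N.
Proof.
pose z : 'I_(k.+1 + m) := lshift m ord0.
rewrite -sum1dep_card (partition_big (fun F : {ffun _} => F z) xpredT) //=.
apply: eq_bigr => t _; rewrite sum1dep_card.
rewrite -(card_imset _ (_ : injective (@prepend k.+1 m t))); last first.
  by move=> F G /ffunP FG; apply/ffunP => x; have := FG (rshift _ x); rewrite !prependR.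
apply: eq_card => F; rewrite !inE; apply/idP/imsetP.
  case/andP=> /andP[/forallP Fc /forallP Fa] /eqP Fz.
  have FE : F = prepend k.+1 t [ffun x => F (rshift k.+1 x)].
    apply/ffunP => x; rewrite -[x]splitK; case: split => y.
      rewrite prependL -Fz; apply/eqP.
      by have /forallP/(_ z) := Fc (lshift m y); rewrite /= ltn_ord.
    by rewrite prependR ffunE.
  exists [ffun x => F (rshift k.+1 x)] => //; rewrite inE; apply/forallP => t'.
  by rewrite -occ_prepend -FE.
case=> G; rewrite inE => /forallP Ga ->; apply/andP; split; last by rewrite prependL.
apply/andP; split; last by apply/forallP => t'; rewrite occ_prepend.
apply/forallP => x; apply/forallP => y; apply/implyP.
rewrite -[x]splitK -[y]splitK; have hi (z' : 'I_m) : (rshift k.+1 z' < k.+1)%N = false by rewrite ltnNge leq_addr.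
case: split => x'; rewrite ?hi //; case: split => y'; rewrite ?hi ?andbF //.
by rewrite !prependL.
Qed.

(** The multinomial formula, by induction on the length, splitting off the first
    letter. *)
Lemma card_words_of_content m (a : T -> nat) : (\sum_t a t = m)%N ->
  (#|[set F : {ffun 'I_m -> T} | [forall t, occ F t == a t]]| * \prod_t (a t)`! = m`!)%N.
Proof.
elim: m a => [|m IHm] a sum_a.
  have a0 t : a t = 0%N.
    by apply/eqP; rewrite -leqn0 -sum_a (bigD1 t) //= leq_addr.
  rewrite big1 ?muln1 => [|t _]; last by rewrite a0.
  rewrite [X in #|pred_of_set X|](_ : _ = setT) ?cardsT ?card_ffun ?card_ord //.
  by apply/setP => F; rewrite !inE; apply/forallP => t; rewrite a0 /occ big_ord0.
have -> : #|[set F : {ffun 'I_m.+1 -> T} | [forall t, occ F t == a t]]| =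
    (\sum_t #|[set F : {ffun 'I_m -> T} | [forall t', occ F t' + 1 * (t == t') == a t']]|)%N.
  rewrite -(card_const_on 0 m a); apply: eq_card => F; rewrite !inE.
  suff -> : const_on 1 F by [].
  apply/forallP => x; apply/forallP => y; apply/implyP.
  rewrite !ltnS !leqn0 => /andP[/eqP x0 /eqP y0].
  by apply/eqP; congr (F _); apply: val_inj; exact: etrans x0 (esym y0).
rewrite big_distrl /= factS -sum_a big_distrl; apply: eq_bigr => t _ /=.
case: (posnP (a t)) => [at0|at_gt0].
  rewrite at0 mul0n [X in #|pred_of_set X|](_ : _ = set0) ?cards0 //.
  by apply/setP => F; rewrite !inE; apply/negbTE/forallPn; exists t; rewrite at0 eqxx addn1.
pose b t' := (a t' - (t == t'))%N.
have ab t' : a t' = (b t' + (t == t'))%N by rewrite subnK //; case: eqP => // <-.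
rewrite -(IHm b); last first.
  apply: succn_inj; rewrite -[RHS]sum_a (bigD1 t) //= [in RHS](bigD1 t) //= -addSn -addn1.
  rewrite [in RHS]ab eqxx; congr (_ + _)%N; apply: eq_bigr => t' /negPf ne.
  by rewrite [in RHS]ab eq_sym ne addn0.
rewrite mulnCA; congr (_ * _)%N.
  by apply: eq_card => F; rewrite !inE; apply: eq_forallb => t'; rewrite mul1n {1}ab eqn_add2r.
rewrite (bigD1 t) //= [in RHS](bigD1 t) //= mulnA; congr (_ * _)%N.
  by rewrite /b eqxx subn1; case: (a t) at_gt0.
by apply: eq_bigr => t'; rewrite eq_sym /b => /negPf->; rewrite subn0.
Qed.
End Words.

Section Action.
Variables (T : finType) (n : nat).
Implicit Types (F G : {ffun 'I_n -> T}) (s y z : 'S_n).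

Definition pact y F : {ffun 'I_n -> T} := [ffun x => F (y x)].

Lemma pact1 F : pact 1%g F = F.
Proof. by apply/ffunP => x; rewrite ffunE perm1. Qed.

Lemma pactM y z F : pact (y * z)%g F = pact y (pact z F).
Proof. by apply/ffunP => x; rewrite !ffunE permM. Qed.

Lemma occ_pact y F : occ (pact y F) =1 occ F.
Proof.
move=> t; rewrite /occ [RHS](reindex_inj (@perm_inj _ y)).
by apply: eq_bigr => x _; rewrite ffunE.
Qed.

(** Words with the same content are permutations of each other. *)
Lemma pact_trans F G : occ F =1 occ G -> exists y, pact y F = G.
Proof.
move=> eq_cnt; pose tu (H : {ffun 'I_n -> T}) := [tuple H x | x < n].
have cntT H t : count_mem t (tu H) = occ H t.
  by rewrite /= count_map -sumn_count /= sumnE big_map /occ big_enum.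
have /tuple_permP[y yE] : perm_eq (tu G) (tu F).
  apply/allP => t _ /=; by rewrite [X in X == _]cntT [X in _ == X]cntT eq_cnt.
exists y; apply/ffunP => x; rewrite ffunE.
by have := congr1 (fun t : n.-tuple T => tnth t x) (val_inj yE); rewrite !tnth_mktuple.
Qed.

Definition pstab F : nat := #|[set s | pact s F == F]|.

(** The permutations that send F to G form a coset of the stabiliser of either. *)
Lemma card_pact F G : occ F =1 occ G ->
  #|[set y | pact y F == G]| = pstab F /\ #|[set y | pact y F == G]| = pstab G.
Proof.
case/pact_trans => y0 y0E; split.
  rewrite /pstab -[RHS](card_imset _ (mulgI y0)); apply: eq_card => y; rewrite !inE.
  apply/eqP/imsetP => [yE|[s]]; last by rewrite inE => /eqP sF ->; rewrite pactM sF.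
  exists (y0^-1 * y)%g; rewrite ?mulKVg // inE pactM yE -y0E -pactM mulVg.
  by rewrite pact1.
rewrite /pstab -[RHS](card_imset _ (mulIg y0)); apply: eq_card => y; rewrite !inE.
apply/eqP/imsetP => [yE|[s]]; last by rewrite inE => /eqP sF ->; rewrite pactM y0E.
exists (y * y0^-1)%g; rewrite ?mulgKV // inE.
by rewrite -{1}y0E -pactM mulgKV yE.
Qed.

Lemma sum_pstab F : (\sum_(G : {ffun 'I_n -> T} | [forall t, occ G t == occ F t]) pstab G = n`!)%N.
Proof.
under eq_bigr => G /forallP FG.
  rewrite -(proj2 (card_pact (fun t => esym (eqP (FG t))))) -sum1dep_card.
over.
rewrite (exchange_big_dep xpredT) //= -[RHS]card_Sn -sum1_card; apply: eq_bigr => y _.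
rewrite (big_pred1 (pact y F)) // => G /=; rewrite [RHS]eq_sym.
by case: eqP => [<-|_]; rewrite ?andbF // andbT; apply/forallP => t; rewrite occ_pact.
Qed.

(** The induced character counts the fixed points of the action on the orbit of
    F, which consists of the words with the content of F. *)
Lemma Ind_fun_stab (e : 'I_n -> nat) F s :
    (forall z, (z \in fun_stab e) = (pact z F == F)) ->
  'Ind[[set: 'S_n], [group of fun_stab e]] 1 s =
    #|[set G | (pact s G == G) && [forall t, occ G t == occ F t]]|%:R :> algC.
Proof.
move=> eF; rewrite cfIndE ?subsetT //.
have -> : \sum_(y in [set: 'S_n]) (1 : 'CF([group of fun_stab e])) (s ^ y)%g =
   (\sum_(y : 'S_n) (pact s (pact y F) == pact y F : nat))%:R :> algC.
  rewrite natr_sum; apply: eq_big => [y|y _]; first by rewrite inE.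
  rewrite cfun1E eF; congr (nat_of_bool _)%:R.
  have pinj z : injective (pact z).
    by apply: (can_inj (g := pact z^-1)) => G; rewrite -pactM mulVg pact1.
  have <- := inj_eq (pinj y^-1%g) (pact s (pact y F)).
  by rewrite -!pactM mulVg pact1 -mulgA.
have -> : #|[group of fun_stab e]| = pstab F by apply: eq_card => z; rewrite eF inE.
have pstab_gt0 : (0 < pstab F)%N.
  by apply/card_gt0P; exists 1%g; rewrite inE pact1.
apply: (mulfI (_ : (pstab F)%:R != 0)); first by rewrite pnatr_eq0 -lt0n.
rewrite mulVKf ?pnatr_eq0 -?lt0n // -natrM; congr _%:R.
rewrite -sum1dep_card big_distrr /= muln1.
rewrite (partition_big (fun y => pact y F) (fun G => [forall t, occ G t == occ F t])) /=;
  last first.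
  by move=> y _; apply/forallP => t; rewrite occ_pact.
rewrite big_mkcond [RHS]big_mkcond; apply: eq_bigr => G _.
rewrite andbC; case: forallP => //= FG.
transitivity (\sum_(y | pact y F == G) (pact s G == G : nat))%N.
  by apply: eq_bigr => y /eqP->.
rewrite sum_nat_const -(proj1 (card_pact (fun t => esym (eqP (FG t))))).
by rewrite -cardsE; case: (_ == G); rewrite ?muln1 ?muln0.
Qed.
End Action.

(** * The bialternant formula *)

Section Bialternant.
Variables (L N : nat).
Local Notation B := {mpoly int[L]}.
Local Notation rev i := (rev_ord i : nat).
Local Notation X := (fps_X B).

Definition monomial (e : 'I_L -> nat) : B := \prod_j 'X_j ^+ e j.

Lemma monomialE e : monomial e = 'X_[[multinom e j | j < L]].
Proof. by rewrite mpolyXE_id; apply: eq_bigr => j _; rewrite mnmE. Qed.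

Lemma monomialD e e' : monomial e * monomial e' = monomial (fun j => e j + e' j)%N.
Proof. by rewrite /monomial -big_split; apply: eq_bigr => j _; rewrite exprD. Qed.

Lemma monomial_sum I (r : seq I) (e : I -> 'I_L -> nat) :
  \prod_(i <- r) monomial (e i) = monomial (fun j => \sum_(i <- r) e i j)%N.
Proof.
elim: r => [|i r IHr]; first by rewrite big_nil /monomial big1 // => j _; rewrite big_nil.
by rewrite big_cons IHr monomialD; apply: eq_bigr => j _; rewrite big_cons.
Qed.

Lemma mcoeff_monomial e (a : 'I_L -> nat) :
  (monomial e)@_[multinom a j | j < L] = [forall j, e j == a j]%:R.
Proof.
rewrite monomialE mcoeffX; congr (nat_of_bool _)%:R; apply/eqP/forallP => [/mnmP E j|E].
  by apply/eqP; have := E j; rewrite !mnmE.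
by apply/mnmP => j; rewrite !mnmE; apply/eqP.
Qed.

(** The generating series of the complete homogeneous polynomials. *)
Definition complete_sym : fps B := \prod_(j < L) geom ('X_j : B).

Lemma complete_symE d : (d <= N)%N ->
  complete_sym d = \sum_(m : {ffun 'I_L -> 'I_N.+1} | (\sum_j m j == d)%N) monomial (fun j => m j).
Proof.
move=> le_dN; pose gt (y : B) : fps B := \sum_(m < N.+1) fpsC (y ^+ m) * X ^+ m.
have gtE y i : (i <= N)%N -> geom y i = gt y i.
  move=> le_iN; rewrite /gt fps_sumE (bigD1 (Ordinal (le_iN : i < N.+1)%N)) //= big1 => [|m ne_mi].
    by rewrite fpsC_mul -[X ^+ i]mulr1 fpsMXn leqnn subnn mulr1 addr0.
  rewrite fpsC_mul -[X ^+ m]mulr1 fpsMXn fps1; case: ifP => [le_mi|]; rewrite ?mulr0 //.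
  rewrite subn_eq0 leqNgt ltn_neqAle le_mi andbT.
  by rewrite (inj_eq val_inj m (Ordinal (le_iN : i < N.+1)%N)) ne_mi mulr0.
have prodE (r : seq 'I_L) i : (i <= N)%N ->
    (\prod_(j <- r) geom ('X_j : B)) i = (\prod_(j <- r) gt 'X_j) i.
  elim: r i => [|j r IHr] i le_iN; first by rewrite !big_nil.
  by rewrite !big_cons; apply: fpsM_congr => l le_li; [apply: gtE | apply: IHr];
    apply: leq_trans le_iN.
rewrite /complete_sym prodE // bigA_distr_bigA fps_sumE big_mkcond [RHS]big_mkcond.
apply: eq_bigr => m _; rewrite big_split /= -rmorph_prod fpsC_mul.
rewrite -[\prod_(i < L) X ^+ m i]mulr1.
have -> : \prod_(i < L) X ^+ m i = X ^+ (\sum_j m j).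
  by elim/big_rec2: _ => // i x y _ ->; rewrite exprD.
rewrite fpsMXn fps1 subn_eq0 [_ == d]eq_sym eqn_leq [RHS]if_and.
by case: (d <= _)%N; case: (_ <= d)%N; rewrite ?mulr0 ?mulr1.
Qed.

Definition jacobi_trudi_mx (a : 'I_L -> nat) : 'M[B]_L :=
  \matrix_(i, j) if (rev j <= a i)%N then complete_sym (a i - rev j)%N else 0.
Definition alternant_mx (a : 'I_L -> nat) : 'M[B]_L := \matrix_(i, j) 'X_j ^+ a i.

Lemma prod_lin_high (A : comNzRingType) (s : seq A) d : (size s < d)%N ->
  (\prod_(c <- s) lin_factor c) d = 0.
Proof.
elim: s d => [|c s IHs] d; first by rewrite big_nil fps1; case: d.
case: d => // d lt_sd; rewrite big_cons /lin_factor mulrBl mul1r fpsB -mulrA fpsC_mul fpsMX.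
by rewrite !IHs ?mulr0 ?subrr // ltnW.
Qed.

(** Let E be the matrix of coefficients of the polynomials
    \prod_(j' != j) (1 - y_j' X).  Since complete_sym times such a polynomial is
    1 / (1 - y_j X), the matrix of complete polynomials times E is the alternant
    matrix, whatever a is.  For the smallest a the first factor is unitriangular,
    which gives det E. *)
Lemma bialternant (a : 'I_L -> nat) :
  \det (jacobi_trudi_mx a) * \det (alternant_mx (fun i => rev i)) = \det (alternant_mx a).
Proof.
pose e (j : 'I_L) : fps B := \prod_(j' | j' != j) lin_factor ('X_j' : B).
pose E : 'M[B]_L := \matrix_(i, j) e j (rev i).
have HE b : jacobi_trudi_mx b *m E = alternant_mx b.
  apply/matrixP => i j; rewrite !mxE.
  have -> : 'X_j ^+ b i = (complete_sym * e j) (b i).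
    rewrite /complete_sym (bigD1 j) //= -mulrA -big_split /= [X in _ * X]big1 ?mulr1 // => j' _.
    by rewrite mulrC geomK.
  rewrite mulrC fpsM (reindex_inj rev_ord_inj) /=.
  pose f d : B := if (d <= b i)%N then e j d * complete_sym (b i - d)%N else 0.
  have e_high d : (L <= d)%N -> e j d = 0.
    move=> le_Ld; rewrite /e -big_filter -(big_map _ xpredT (@lin_factor B)) prod_lin_high // size_map.
    have lt : (size [seq j' <- index_enum 'I_L | j' != j] < L)%N.
      rewrite -[X in (_ < X)%N]card_ord (cardD1 j) inE add1n ltnS.
      rewrite -sum1_size big_filter -sum1_card leq_eqVlt; apply/orP; left; apply/eqP.
      by apply: eq_bigl => j'; rewrite !inE andbT.
    exact: leq_trans le_Ld.
  transitivity (\sum_(d < L) f d).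
    apply: eq_bigr => d _; rewrite !mxE rev_ordK /f.
    by case: ifP => _; rewrite ?mul0r // mulrC.
  transitivity (\sum_(d < L + (b i).+1) f d).
    rewrite (big_ord_widen _ f (leq_addr (b i).+1 L)) big_mkcond; apply: eq_bigr => d _.
    by case: ltnP => // le_Ld; rewrite /f e_high // mul0r if_same.
  rewrite (eq_bigr (fun d : 'I_(b i).+1 => f d)); last first.
    by move=> d _; rewrite /f -ltnS ltn_ord.
  rewrite (big_ord_widen _ f (leq_addl L (b i).+1)) [RHS]big_mkcond; apply: eq_bigr => d _.
  by rewrite ltnS /f; case: ifP.
have detE : \det E = \det (alternant_mx (fun i => rev i)).
  rewrite -(HE (fun i => rev i)) det_mulmx -det_tr det_trig.
    rewrite big1 ?mul1r // => i _; rewrite !mxE leqnn subnn /complete_sym fps_prod0 big1 //.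
  apply/is_trig_mxP => i j lt_ij; rewrite !mxE leqNgt.
  by rewrite /= ltn_sub2l // (leq_ltn_trans lt_ij).
by rewrite -(HE a) det_mulmx detE.
Qed.

Definition sgn (s : 'S_L) : int := (-1) ^+ s.

(** Extracting the coefficient of y^a from the bialternant formula turns the
    product of determinants into this signed count of matrices, the rows coming
    from the complete polynomials and the columns from the alternant. *)
Lemma orthonormality (a : 'I_L -> nat) : injective a -> (forall i, a i <= N)%N ->
  \sum_s \sum_t sgn s * sgn t *
    #|[set M : {ffun 'I_L -> {ffun 'I_L -> 'I_N.+1}} |
       [forall i, \sum_j M i j + rev (s i) == a i]%N &
       [forall j, \sum_i M i j + rev (t j) == a j]%N]|%:R = 1.
Proof.
move=> a_inj a_le; pose al := [multinom a j | j < L].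
have := congr1 (mcoeff al) (bialternant a).
rewrite -![\det (alternant_mx _)]det_tr.
have -> : (\det (alternant_mx a)^T)@_al = 1.
  rewrite raddf_sum (bigD1 1%g) //= [X in _ + X]big1 => [|s ne_s1].
    rewrite addr0 odd_perm1 expr0 mul1r [\prod_i _](_ : _ = monomial a).
      by rewrite mcoeff_monomial; case: forallP => // -[] j.
    by apply: eq_bigr => i _; rewrite !mxE perm1.
  rewrite [\prod_i _](_ : _ = monomial (fun i => a (s i))); last first.
    by apply: eq_bigr => i _; rewrite !mxE.
  have -> : (-1) ^+ s = ((-1) ^+ s)%:MP_[L] :> B by rewrite rmorphXn rmorphN1.
  rewrite mul_mpolyC mcoeffZ mcoeff_monomial; case: forallP; rewrite ?mulr0 // => sa.
  case/eqP: ne_s1; apply/permP => i; rewrite perm1; apply: a_inj; exact/eqP.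
move=> det1; rewrite -[RHS]det1 /determinant.
rewrite mulr_suml raddf_sum; apply: eq_bigr => s _ /=.
rewrite mulr_sumr raddf_sum; apply: eq_bigr => t _ /=.
have -> : \prod_i (alternant_mx (fun i => rev i))^T i (t i) = monomial (fun i => rev (t i)).
  by apply: eq_bigr => i _; rewrite !mxE.
have -> : \prod_i jacobi_trudi_mx a i (s i) = \sum_(M : {ffun 'I_L -> {ffun 'I_L -> 'I_N.+1}} |
    [forall i, \sum_j M i j + rev (s i) == a i]%N) monomial (fun j => \sum_i M i j)%N.
  transitivity (\prod_i \sum_(m : {ffun 'I_L -> 'I_N.+1} |
      (\sum_j m j + rev (s i) == a i)%N) monomial (fun j => m j)).
    apply: eq_bigr => i _; rewrite mxE; case: leqP => [le_sa|lt_as].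
      rewrite complete_symE ?(leq_trans (leq_subr _ _)) //; apply: eq_bigl => m.
      by rewrite -(eqn_add2r (rev (s i))) subnK.
    rewrite big_pred0 // => m; apply/negbTE; rewrite neq_ltn orbC.
    by rewrite (leq_trans lt_as) // leq_addl.
  rewrite bigA_distr_big_dep; apply: eq_big => [M|M _]; last exact: monomial_sum.
  by apply/familyP/forallP.
rewrite mulrACA.
have -> : (-1) ^+ s * (-1) ^+ t = (sgn s * sgn t)%:MP_[L] :> B.
  by rewrite rmorphM !rmorphXn !rmorphN1.
rewrite mul_mpolyC mcoeffZ; congr (_ * _).
rewrite mulr_suml raddf_sum -sum1dep_card natr_sum big_mkcondr; apply: eq_bigr => M _ /=.
by rewrite monomialD mcoeff_monomial; case: forallP.
Qed.
End Bialternant.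

(** * The Frobenius virtual character has norm one *)

Section Gram.
Variables (L n : nat) (a : 'I_L -> nat).
Hypothesis a_inj : injective a.
Hypothesis a_sum : (\sum_i a i = n + \sum_(i < L) rev_ord i)%N.
Local Notation T := ('I_L * 'I_L)%type.
Local Notation Sn := [set: 'S_n].

(** With a_i = w_i + rev i, the content is w_i - i + s(i); the formulation with
    sums avoids negative numbers. *)
Definition has_content (s : 'S_L) (F : {ffun 'I_n -> 'I_L}) : bool :=
  [forall i, occ F i + rev_ord (s i) == a i]%N.

Lemma has_contentP s F G : has_content s F -> has_content s G = [forall i, occ G i == occ F i].
Proof. by move/forallP => sF; apply: eq_forallb => i; rewrite -(eqP (sF i)) eqn_add2r. Qed.

(** It is zero when the required content has a negative entry. *)
Definition permchar (s : 'S_L) : 'CF(Sn) :=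
  if [pick F | has_content s F] is Some F
  then 'Ind[Sn, [group of fun_stab (fun x => F x : nat)]] 1 else 0.

Lemma permchar_char s : permchar s \is a character.
Proof.
by rewrite /permchar; case: pickP => [F _|_];
  [rewrite cfInd_char ?cfun1_char | rewrite cfun0_char].
Qed.

Lemma fun_stab_val (F : {ffun 'I_n -> 'I_L}) z :
  (z \in fun_stab (fun x => F x : nat)) = (pact z F == F).
Proof.
rewrite inE; apply/forallP/eqP => [zF|zF x]; last by rewrite -[in X in _ == X]zF ffunE.
by apply/ffunP => x; rewrite ffunE; apply: val_inj; apply/eqP/zF.
Qed.

Lemma permcharE s z :
  permchar s z = #|[set G | (pact z G == G) && has_content s G]|%:R.
Proof.
rewrite /permchar; case: pickP => [F sF|no_F].
  rewrite (Ind_fun_stab _ (fun_stab_val F)); congr _%:R; apply: eq_card => G.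
  by rewrite !inE (has_contentP _ sF).
by rewrite cfunE [X in #|pred_of_set X|](_ : _ = set0) ?cards0 //; apply/setP => G;
  rewrite !inE no_F andbF.
Qed.

Definition frobenius_char : 'CF(Sn) := \sum_(s : 'S_L) (-1) ^+ s *: permchar s.

Lemma frobenius_vchar : frobenius_char \in 'Z[irr Sn]%g.
Proof.
apply: rpred_sum => s _; rewrite rpredZsign.
exact: char_vchar (permchar_char s).
Qed.

Definition content_mx (N : nat) (P : {ffun 'I_n -> T}) : {ffun 'I_L -> {ffun 'I_L -> 'I_N.+1}} :=
  [ffun i => [ffun j => inord (occ P (i, j))]].

Lemma occ_le m (S : finType) (F : {ffun 'I_m -> S}) t : (occ F t <= m)%N.
Proof. by rewrite -{2}(sum_occ F) (bigD1 t) //= leq_addr. Qed.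

(** By Burnside's lemma the inner product counts the orbits of pairs of words;
    a pair is a word in pairs of letters, and its orbit is its content, a matrix
    with prescribed margins. *)
Lemma permchar_gram N (s t : 'S_L) : (n <= N)%N ->
  '[permchar s, permchar t] =
    #|[set M : {ffun 'I_L -> {ffun 'I_L -> 'I_N.+1}} |
       [forall i, \sum_j M i j + rev_ord (s i) == a i]%N &
       [forall j, \sum_i M i j + rev_ord (t j) == a j]%N]|%:R.
Proof.
move=> le_nN; rewrite cfdotE cardsT card_Sn.
have n_neq0 : (n`!)%:R != 0 :> algC by rewrite pnatr_eq0 -lt0n fact_gt0.
apply: (mulfI n_neq0); rewrite mulVKf // -natrM.
under eq_bigr do rewrite !permcharE rmorph_nat -natrM.
rewrite -natr_sum; congr _%:R.
pose f1 (P : {ffun 'I_n -> T}) := [ffun x => (P x).1].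
pose f2 (P : {ffun 'I_n -> T}) := [ffun x => (P x).2].
pose C P := has_content s (f1 P) && has_content t (f2 P).
have pactE z P : (pact z P == P) = (pact z (f1 P) == f1 P) && (pact z (f2 P) == f2 P).
  apply/eqP/andP => [zP|[/eqP/ffunP z1 /eqP/ffunP z2]].
    by split; apply/eqP/ffunP => x; rewrite !ffunE -[in RHS]zP ffunE.
  apply/ffunP => x; have := z1 x; have := z2 x; rewrite !ffunE.
  by case: (P x) => u v; case: (P (z x)) => u' v' /= -> ->.
have cnt1 P i : occ (f1 P) i = (\sum_j occ P (i, j))%N.
  rewrite exchange_big; apply: eq_bigr => x _ /=; rewrite ffunE.
  case: (P x) => u v /=; rewrite (bigD1 v) //= big1 ?addn0 => [|v' ne];
    first by rewrite xpair_eqE eqxx andbT.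
  by rewrite xpair_eqE [v == _]eq_sym (negPf ne) andbF.
have cnt2 P j : occ (f2 P) j = (\sum_i occ P (i, j))%N.
  rewrite exchange_big; apply: eq_bigr => x _ /=; rewrite ffunE.
  case: (P x) => u v /=; rewrite (bigD1 u) //= big1 ?addn0 => [|u' ne];
    first by rewrite xpair_eqE eqxx.
  by rewrite xpair_eqE [u == _]eq_sym (negPf ne).
have -> : (\sum_(z in Sn) #|[set G | (pact z G == G) && has_content s G]| *
     #|[set G | (pact z G == G) && has_content t G]| = \sum_(P | C P) pstab P)%N.
  under [RHS]eq_bigr do rewrite /pstab -sum1dep_card.
  rewrite (exchange_big_dep xpredT) //=; apply: eq_big => z; first by rewrite inE.
  move=> _; rewrite -cardsX sum1dep_card.
  have pair_inj : injective (fun P => (f1 P, f2 P)).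
    move=> P Q [/ffunP e1 /ffunP e2]; apply/ffunP => x; have := e1 x; have := e2 x.
    by rewrite !ffunE; case: (P x) (Q x) => [u v] [u' v'] /= -> ->.
  rewrite -[RHS](card_imset _ pair_inj); apply: eq_card => -[F G]; rewrite !inE /=.
  apply/idP/imsetP => [/andP[/andP[F1 F2] /andP[G1 G2]]|[P]].
    pose P : {ffun 'I_n -> T} := [ffun x => (F x, G x)].
    have P1 : f1 P = F by apply/ffunP => x; rewrite !ffunE.
    have P2 : f2 P = G by apply/ffunP => x; rewrite !ffunE.
    by exists P; rewrite ?P1 ?P2 // inE /C pactE P1 P2 F1 F2 G1 G2.
  by rewrite inE /C pactE => /andP[/andP[p1 p2] /andP[c1 c2]] [-> ->]; rewrite p1 p2 c1 c2.
pose Y (M : {ffun 'I_L -> {ffun 'I_L -> 'I_N.+1}}) :=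
  [forall i, \sum_j M i j + rev_ord (s i) == a i]%N &&
  [forall j, \sum_i M i j + rev_ord (t j) == a j]%N.
have mxE' P i j : content_mx N P i j = occ P (i, j) :> nat.
  by rewrite !ffunE inordK // ltnS (leq_trans (occ_le _ _)).
have CY P : C P = Y (content_mx N P).
  rewrite /C /Y /has_content; congr (_ && _); apply: eq_forallb => i.
    by rewrite cnt1; congr (_ + _ == _)%N; apply: eq_bigr => j _; rewrite mxE'.
  by rewrite cnt2; congr (_ + _ == _)%N; apply: eq_bigr => j _; rewrite mxE'.
rewrite (partition_big (content_mx N) Y) => [|P]; last by rewrite CY.
rewrite -sum1dep_card big_distrr /=; apply: eq_bigr => M YM; rewrite muln1.
have M_sum : (\sum_(ij : T) M ij.1 ij.2 = n)%N.
  case/andP: YM => /forallP YM _; apply/eqP; rewrite -(eqn_add2r (\sum_(i < L) rev_ord i)).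
  rewrite -a_sum -(pair_bigA _ (fun i j => M i j : nat)) /=.
  have -> : (\sum_(i < L) rev_ord i = \sum_(i < L) rev_ord (s i))%N.
    by rewrite (reindex_inj (@perm_inj _ s)).
  by rewrite -big_split; apply/eqP; apply: eq_bigr => i _; apply/eqP.
have [Pw PwM] : exists Pw : {ffun 'I_n -> T}, forall ij, occ Pw ij = M ij.1 ij.2.
  have := @card_words_of_content _ _ (fun ij : T => M ij.1 ij.2 : nat) M_sum;
    set A := [set _ | _].
  case: (set_0Vmem A) => [->|[Pw]]; first by rewrite cards0 mul0n => /esym/eqP;
    rewrite -leqn0 leqNgt fact_gt0.
  by rewrite inE => /forallP AP _; exists Pw => ij; apply/eqP.
rewrite -[RHS](sum_pstab Pw); apply: eq_bigl => P.
apply/andP/forallP => [[_ /eqP PM] ij|PP].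
  by rewrite PwM -PM mxE'; case: ij.
have PM : content_mx N P = M.
  by apply/ffunP => i; apply/ffunP => j; apply: val_inj; rewrite [LHS]mxE' (eqP (PP _)) PwM.
by rewrite CY PM YM.
Qed.

Lemma frobenius_norm : '[frobenius_char] = 1.
Proof.
(* A bound for the entries of the matrices and for the exponents a_i. *)
pose N := (n + \sum_i a i)%N.
have a_le i : (a i <= N)%N by rewrite /N (bigD1 i) //= addnCA leq_addr.
rewrite cfdot_suml -[RHS](rmorph1 (intr : int -> algC)) -(orthonormality a_inj a_le).
rewrite rmorph_sum; apply: eq_bigr => s _ /=; rewrite cfdot_sumr rmorph_sum.
apply: eq_bigr => t _ /=; rewrite cfdotZl cfdotZr (@permchar_gram N) ?leq_addr //.
rewrite !rmorphM /= rmorph_nat mulrA; congr (_ * _ * _).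
  by rewrite /sgn rmorphXn rmorphN1.
by rewrite /sgn !rmorphXn !rmorphN1.
Qed.

Lemma frobenius_irr : exists b : bool, exists i, frobenius_char = (-1) ^+ b *: 'chi[Sn]_i.
Proof. exact: vchar_norm1P frobenius_vchar frobenius_norm. Qed.
End Gram.

(** * The irreducible character of a diagram *)

Lemma sign_cfunE n (G : {group 'S_n}) s : sign_cfun G s = (-1) ^+ s *+ (s \in G).
Proof. by rewrite cfunElock. Qed.

Section SignRepr.
Variables (n : nat) (G : {group 'S_n}).

Lemma sign_repr_subproof : mx_repr G (fun s : 'S_n => ((-1) ^+ s)%:M : 'M[algC]_1).
Proof.
split=> [|s t _ _]; first by rewrite odd_perm1.
by rewrite odd_permM signr_addb scalar_mxM.
Qed.

Lemma sign_cfun_char : sign_cfun G \is a character.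
Proof.
have -> : sign_cfun G = cfRepr (MxRepresentation sign_repr_subproof).
  apply/cfun_inP => s Gs; rewrite sign_cfunE cfunE Gs !mulr1n /=.
  by rewrite mxtrace_scalar mulr1n.
exact: cfRepr_char.
Qed.
End SignRepr.

Section Shape.
Variable w : seq nat.
Hypothesis w_part : is_partition w.
Local Notation n := (sumn w).
Local Notation L := (size w).
Local Notation W i := (nth 0%N w i).
Local Notation Sn := [set: 'S_n].

Lemma part_geq i j : (i <= j)%N -> (W j <= W i)%N.
Proof.
case/andP: w_part => w_sorted _ le_ij; case: (ltnP j L) => [lt_jL|?];
  last by rewrite nth_default.
have lt_iL := leq_ltn_trans le_ij lt_jL.
exact: (sorted_leq_nth (rev_trans leq_trans) leqnn) w_sorted _ _ _ _ le_ij.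
Qed.

Definition exponent (i : 'I_L) : nat := (W i + rev_ord i)%N.

Lemma exponent_inj : injective exponent.
Proof.
have lt (i j : 'I_L) : (i < j)%N -> (exponent j < exponent i)%N.
  move=> lt_ij; rewrite /exponent -addnS leq_add ?part_geq ?(ltnW lt_ij) //=.
  by rewrite ltn_sub2l ?ltnS // (leq_ltn_trans lt_ij).
move=> i j eq_ij; apply: val_inj; case: (ltngtP i j) => // /lt; by rewrite eq_ij ltnn.
Qed.

Lemma exponent_sum : (\sum_i exponent i = n + \sum_(i < L) rev_ord i)%N.
Proof. by rewrite big_split; congr (_ + _)%N; rewrite sumnE (big_nth 0%N) big_mkord. Qed.

Definition row (x : 'I_n) : 'I_L := Ordinal (reshape_indexP (ltn_ord x)).
Definition col (x : 'I_n) : nat := reshape_offset w x.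
Definition rows : {ffun 'I_n -> 'I_L} := [ffun x => row x].

Lemma col_lt x : (col x < W (row x))%N. Proof. exact: reshape_offsetP. Qed.

Lemma box_inj x y : row x = row y -> col x = col y -> x = y.
Proof.
move=> /(congr1 val) /= rxy cxy; apply: val_inj => /=.
by rewrite -(reshape_indexK w x) -(reshape_indexK w y) rxy; congr (flatten_index _ _ _).
Qed.

Lemma box_exists (i : 'I_L) c : (c < W i)%N -> exists x, row x = i /\ col x = c.
Proof.
move=> lt_c; exists (Ordinal (flatten_indexP lt_c)).
by split; [apply: val_inj; rewrite /= flatten_indexKl | rewrite /col /= flatten_indexKr].
Qed.

Lemma row_stabE z : (z \in fun_stab (fun x : 'I_n => reshape_index w x)) = (pact z rows == rows).
Proof.
rewrite -fun_stab_val !inE; apply: eq_forallb => x.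
by rewrite !ffunE.
Qed.

Lemma col_stabP (z : 'S_n) : reflect (forall x, col (z x) = col x) (z \in col_stab w).
Proof. by rewrite inE; apply: (iffP forallP) => H x; apply/eqP; exact: H. Qed.

Lemma occ_rows i : occ rows i = W i.
Proof.
rewrite occE -[RHS]card_ord.
have lt_n (c : 'I_(W i)) : (flatten_index w i c < n)%N by apply: flatten_indexP.
pose f (c : 'I_(W i)) : 'I_n := Ordinal (lt_n c).
have rf c : row (f c) = i by apply: val_inj; rewrite /= flatten_indexKl.
have cf c : col (f c) = c by rewrite /col /= flatten_indexKr.
have f_inj : injective f by move=> c d /(congr1 col); rewrite !cf => /val_inj.
rewrite -(card_imset _ f_inj); apply: eq_card => x; rewrite !inE ffunE.
apply/eqP/imsetP => [ri|[c _ ->]]; last exact: rf.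
have lt_x : (col x < W i)%N by rewrite -ri col_lt.
by exists (Ordinal lt_x) => //; apply: box_inj; rewrite ?rf ?cf.
Qed.

Definition col_inj (F : {ffun 'I_n -> 'I_L}) : bool :=
  [forall x, forall y, (col x == col y) && (F x == F y) ==> (x == y)].

Lemma col_injP (F : {ffun 'I_n -> 'I_L}) : reflect (forall x y, col x = col y -> F x = F y -> x = y) (col_inj F).
Proof.
apply: (iffP forallP) => H x.
  move=> y cxy Fxy; apply/eqP; move/forallP/(_ y)/implyP: (H x); apply.
  by rewrite cxy Fxy !eqxx.
by apply/forallP => y; apply/implyP => /andP[/eqP c /eqP F']; apply/eqP/H.
Qed.

(** If two boxes of a column carry the same letter, their transposition reverses
    the sign and the terms cancel; otherwise only the identity fixes F in the
    column stabiliser. *)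
Lemma sum_sign_col (F : {ffun 'I_n -> 'I_L}) :
  \sum_(z in col_stab w | pact z F == F) (-1) ^+ z = (col_inj F)%:R :> algC.
Proof.
case: (boolP (col_inj F)) => [/col_injP Finj|].
  rewrite (big_pred1 1%g) ?odd_perm1 // => z /=.
  apply/andP/eqP => [[/col_stabP zc /eqP zF]|->]; last by rewrite group1 pact1.
  by apply/permP => x; rewrite perm1; apply: Finj; rewrite ?zc // -[in RHS]zF ffunE.
case/forallPn => x /forallPn[y]; rewrite negb_imply => /andP[/andP[/eqP cxy /eqP Fxy] ne_xy].
pose t := tperm x y; have tt : (t * t)%g = 1%g by rewrite tperm2.
have tF : pact t F = F.
  by apply/ffunP => z; rewrite ffunE /t; case: tpermP => [->|->|_ _] //; rewrite Fxy.
have tc : t \in col_stab w by apply/col_stabP => z; rewrite /t;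
  case: tpermP => [->|->|_ _] //; rewrite cxy.
set S := \sum_(z | _) _; apply/eqP; have /eqP : S = - S.
  rewrite {1}/S (reindex_inj (mulgI t)) /= -sumrN; apply: eq_big => [z|z _].
    rewrite groupMl // pactM -{2}tF; congr (_ && _); apply/eqP/eqP => [|->//].
    by move/(congr1 (pact t)); rewrite -!(pactM t t) tt !pact1.
  by rewrite odd_permM odd_tperm ne_xy addTb signrN.
by rewrite -subr_eq0 opprK -mulr2n mulrn_eq0.
Qed.

Definition col_char : 'CF(Sn) := 'Ind[Sn, col_stab w] (sign_cfun (col_stab w)).

Lemma col_char_char : col_char \is a character.
Proof. exact/cfInd_char/sign_cfun_char. Qed.

Lemma permchar_col s : '[col_char, permchar n exponent s] * #|col_stab w|%:R =
  #|[set F | col_inj F && has_content exponent s F]|%:R.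
Proof.
rewrite -Frobenius_reciprocity cfdotE mulrC mulrA mulfV ?mul1r;
  last by rewrite pnatr_eq0 -lt0n cardG_gt0.
transitivity (\sum_(z in col_stab w) \sum_(F | (pact z F == F) && has_content exponent s F) ((-1) ^+ z : algC)).
  apply: eq_bigr => z zc; rewrite sign_cfunE zc mulr1n cfResE ?subsetT // permcharE.
  by rewrite rmorph_nat -sum1dep_card natr_sum mulr_sumr; apply: eq_bigr => F _; rewrite mulr1.
rewrite (exchange_big_dep (has_content exponent s)) /=; last by move=> z F _ /andP[].
rewrite -sum1dep_card natr_sum big_mkcond [RHS]big_mkcond; apply: eq_bigr => F _.
case: ifP => sF; last by rewrite andbF.
rewrite andbT; transitivity ((col_inj F)%:R : algC); last by case: col_inj.
by rewrite -sum_sign_col; apply: eq_bigl => z; rewrite ?sF ?andbT.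
Qed.

(** In column c, at most j boxes carry letters below j, and no more than there
    are boxes; the word of row indices attains the smaller bound. *)
Lemma col_inj_count (F : {ffun 'I_n -> 'I_L}) c j : col_inj F ->
  (#|[set x | (col x == c) && (F x < j)]| <= #|[set x | (col x == c) && (row x < j)]|)%N.
Proof.
move/col_injP => Finj; case: (ltnP c (W j)) => [lt_cj|le_jc]; last first.
  apply: subset_leq_card; apply/subsetP => x; rewrite !inE => /andP[cx _]; rewrite cx /=.
  rewrite ltnNge; apply/negP => /part_geq; rewrite leqNgt; apply/negP; rewrite negbK.
  by rewrite (leq_ltn_trans le_jc) // -(eqP cx) col_lt.
have lt_jL : (j < L)%N by rewrite ltnNge; apply: contraL lt_cj => ?; rewrite nth_default.
have row_inj : {in [set x | (col x == c) && (row x < j)%N] &, injective row}.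
  by move=> x y; rewrite !inE => /andP[/eqP cx _] /andP[/eqP cy _] /box_inj; apply;
    rewrite cx cy.
have F_inj : {in [set x | (col x == c) && (F x < j)%N] &, injective F}.
  by move=> x y; rewrite !inE => /andP[/eqP cx _] /andP[/eqP cy _] /Finj; apply; rewrite cx cy.
rewrite -(card_in_imset row_inj) -(card_in_imset F_inj); apply: subset_leq_card.
apply/subsetP => i /imsetP[x]; rewrite inE => /andP[_ lt_Fx] ->.
have lt_c : (c < W (F x))%N by rewrite (leq_trans lt_cj) // part_geq // ltnW.
by have [y [ry cy]] := box_exists lt_c; apply/imsetP; exists y; rewrite ?inE ?ry ?cy ?eqxx.
Qed.

Lemma sum_col_count (F : {ffun 'I_n -> 'I_L}) j :
  (\sum_(c < n.+1) #|[set x | (col x == c) && (F x < j)]| = \sum_(i < L | i < j) occ F i)%N.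
Proof.
under eq_bigr do rewrite -sum1dep_card.
rewrite (exchange_big_dep (fun x => F x < j)%N) /=; last by move=> c x _ /andP[].
rewrite [RHS](exchange_big_dep xpredT) //= big_mkcond; apply: eq_bigr => x _.
have lt_cn : (col x < n.+1)%N.
  rewrite ltnS (leq_trans (ltnW (col_lt x))) // -(occ_rows) occ_le //.
case: ifP => Fx.
  rewrite (big_pred1 (Ordinal lt_cn)) => [|c]; last by rewrite /= ?Fx ?andbT -val_eqE /= eq_sym.
  rewrite (bigD1 (F x)) ?Fx //=. by rewrite eqxx big1 // => i /andP[_];
    rewrite eq_sym => /negPf->.
by rewrite big1 // => i /andP[lt_ij _]; case: eqP => // Fi; rewrite Fi lt_ij in Fx.
Qed.

Lemma col_inj_dominance (F : {ffun 'I_n -> 'I_L}) j : col_inj F ->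
  (\sum_(i < L | i < j) occ F i <= \sum_(i < L | i < j) W i)%N.
Proof.
move=> Fi; rewrite -sum_col_count.
under [leqRHS]eq_bigr do rewrite -occ_rows.
rewrite -sum_col_count; apply: leq_sum => c _.
have -> : [set x | (col x == c) && (rows x < j)%N] = [set x | (col x == c) && (row x < j)%N].
  by apply/setP => x; rewrite !inE ffunE.
exact: col_inj_count.
Qed.

(** The partial sums of the content of F are those of w_i - i + s(i); by
    col_inj_dominance they are at most those of w, which forces s(i) <= i for
    each i in turn. *)
Lemma col_inj_content_1 (F : {ffun 'I_n -> 'I_L}) s :
  col_inj F -> has_content exponent s F -> s = 1%g.
Proof.
move=> Finj /forallP sF; apply/permP => i; rewrite perm1.
have [m le_im] := ubnP (i : nat); elim: m => // m IHm in i le_im *.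
have s_fix (i' : 'I_L) : (i' < i)%N -> s i' = i'.
  by move=> lt_i'; apply: IHm; rewrite (leq_trans lt_i').
have le_si : (s i <= i)%N.
  have := col_inj_dominance i.+1 Finj.
  rewrite -(leq_add2r (\sum_(i' < L | (i' < i.+1)%N) rev_ord (s i'))) -big_split /=.
  under eq_bigr => i' _ do rewrite (eqP (sF i')).
  rewrite big_split /= leq_add2l (bigD1 i) //= [leqRHS](bigD1 i) //=.
  rewrite (eq_bigr (fun i' : 'I_L => (L - (s i').+1)%N)) => [|i' /andP[lt_i' ne_i']];
    last first.
    by rewrite s_fix // ltn_neqAle ne_i'.
  by rewrite leq_add2r leq_sub2lE.
apply: val_inj; apply/eqP; rewrite eqn_leq le_si leqNgt; apply/negP => lt_si.
by have /perm_inj/(congr1 val) e := s_fix _ lt_si; rewrite e ltnn in lt_si.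
Qed.

Lemma has_content_1 (F : {ffun 'I_n -> 'I_L}) : has_content exponent 1%g F = [forall i, occ F i == W i].
Proof. by apply: eq_forallb => i; rewrite perm1 /exponent eqn_add2r. Qed.

(** Both sides have the same sum over the columns and one inequality holds
    column by column. *)
Lemma col_inj_count_eq (F : {ffun 'I_n -> 'I_L}) c j : col_inj F -> (forall i, occ F i = W i) ->
  (c <= n)%N ->
  #|[set x | (col x == c) && (F x < j)%N]| = #|[set x | (col x == c) && (row x < j)%N]|.
Proof.
move=> Finj FW le_cn; have rowsE d : #|[set x | (col x == d) && (rows x < j)%N]| =
    #|[set x | (col x == d) && (row x < j)%N]|.
  by apply: eq_card => x; rewrite !inE ffunE.
have := sum_col_count F j; under [RHS]eq_bigr do rewrite FW -occ_rows.
rewrite -sum_col_count => /eqP; rewrite eqn_leq => /andP[_].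
under [leqLHS]eq_bigr do rewrite rowsE.
rewrite (bigD1 (Ordinal (le_cn : c < n.+1)%N)) //= [leqRHS](bigD1 (Ordinal (le_cn : c < n.+1)%N)) //=.
move=> le_sum; apply/eqP; rewrite eqn_leq col_inj_count //=.
rewrite -(leq_add2r (\sum_(i < n.+1 | i != Ordinal (le_cn : c < n.+1)%N)
   #|[set x | (col x == i) && (row x < j)%N]|)%N).
by rewrite (leq_trans le_sum) // leq_add2l leq_sum // => d _; apply: col_inj_count.
Qed.

(** By col_inj_count_eq a column-injective word with the content of the rows is
    obtained from the word of row indices by permuting each column, in a unique way. *)
Lemma card_col_inj :
  #|[set F | col_inj F && has_content exponent 1%g F]| = #|col_stab w|.
Proof.
pose f (z : 'S_n) : {ffun 'I_n -> 'I_L} := [ffun x => row (z x)].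
have f_inj : {in col_stab w &, injective f}.
  move=> y z /col_stabP yc /col_stabP zc /ffunP eq_f; apply/permP => x.
  by apply: box_inj; [have := eq_f x; rewrite !ffunE | rewrite yc zc].
rewrite -(card_in_imset f_inj); apply: eq_card => F; rewrite !inE has_content_1.
apply/andP/imsetP => [[Finj /forallP FW]|[z zc ->]]; last first.
  move/col_stabP: zc => zc; split; last first.
    apply/forallP => i; rewrite -occ_rows -(occ_pact z rows).
    by apply/eqP; apply: eq_bigr => x _; rewrite !ffunE.
  apply/col_injP => x y cxy; rewrite !ffunE => rxy; apply: (@perm_inj _ z).
  by apply: box_inj; rewrite ?zc.
have {}FW i : occ F i = W i := eqP (FW i).
have lt_col x : (col x < W (F x))%N.
  have le_cn : (col x <= n)%N by rewrite (leq_trans (ltnW (col_lt x))) // -occ_rows occ_le.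
  have F_S (G : 'I_n -> 'I_L) : #|[set y | (col y == col x) && (G y < (F x).+1)%N]| =
     (#|[set y | (col y == col x) && (G y < F x)%N]| + #|[set y | (col y == col x) && (G y == F x)]|)%N.
    rewrite -!sum1dep_card big_mkcond [in RHS]big_mkcond [in X in (_ + X)%N]big_mkcond -big_split.
    apply: eq_bigr => y _ /=; rewrite ltnS leq_eqVlt -val_eqE /=.
    by case: (_ == _) => //=; case: ltngtP.
  have := col_inj_count_eq (F x).+1 Finj FW le_cn; rewrite F_S (F_S row).
  rewrite (col_inj_count_eq (F x) Finj FW le_cn) => /addnI eq_cnt.
  have : (0 < #|[set y | (col y == col x) && (F y == F x)]|)%N.
    by apply/card_gt0P; exists x; rewrite inE !eqxx.
  by rewrite eq_cnt => /card_gt0P[y]; rewrite inE => /andP[/eqP <- /eqP <-]; apply: col_lt.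
have ex_g x : exists y, (row y == F x) && (col y == col x).
  by have [y [ry cy]] := box_exists (lt_col x); exists y; rewrite ry cy !eqxx.
pose g x := xchoose (ex_g x).
have [rg cg] : (forall x, row (g x) = F x) /\ (forall x, col (g x) = col x).
  by split=> x; have /andP[/eqP ? /eqP ?] := xchooseP (ex_g x).
have g_inj : injective g.
  move=> x y gxy; apply: (col_injP F Finj); first by rewrite -cg gxy cg.
  by rewrite -rg gxy rg.
exists (perm g_inj); first by apply/col_stabP => x; rewrite permE cg.
by apply/ffunP => x; rewrite ffunE permE rg.
Qed.

Lemma permchar_row : permchar n exponent 1%g = 'Ind[Sn, row_stab w] 1.
Proof.
apply/cfunP => z; rewrite permcharE (Ind_fun_stab _ row_stabE); congr _%:R.
apply: eq_card => G; rewrite !inE has_content_1; congr (_ && _).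
by apply: eq_forallb => i; rewrite occ_rows.
Qed.

Lemma col_char_orthogonal s : s != 1%g -> '[col_char, permchar n exponent s] = 0.
Proof.
move=> ne_s1; have nz : #|col_stab w|%:R != 0 :> algC by rewrite pnatr_eq0 -lt0n cardG_gt0.
apply: (mulIf nz); rewrite permchar_col mul0r; apply/eqP; rewrite pnatr_eq0 cards_eq0.
apply/eqP/setP => F; rewrite !inE; apply/negbTE/andP => -[Finj /(col_inj_content_1 Finj) s1].
by rewrite s1 eqxx in ne_s1.
Qed.

Lemma col_char_row : '[col_char, permchar n exponent 1%g] = 1.
Proof.
have nz : #|col_stab w|%:R != 0 :> algC by rewrite pnatr_eq0 -lt0n cardG_gt0.
by apply: (mulIf nz); rewrite permchar_col mul1r card_col_inj.
Qed.

(** Frobenius' virtual character is an irreducible character up to sign.  It has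
    inner product 1 with the character induced by the sign of the column
    stabiliser, and only its term s = 1 contributes, the other terms being
    characters orthogonal to it.  Hence the irreducible character occurs in that
    term, which is induced from the row stabiliser; as the two induced characters
    have inner product 1, it is their only common constituent. *)
Lemma frobenius_sym_chi : exists b : bool, frobenius_char n exponent = (-1) ^+ b *: sym_chi w.
Proof.
have [b [i frobE]] := frobenius_irr exponent_inj exponent_sum.
have psi_char s := permchar_char n exponent s.
have frob_col : '[col_char, frobenius_char n exponent] = 1.
  rewrite cfdot_sumr (bigD1 1%g) //= big1 => [|s ne_s1].
    by rewrite odd_perm1 scale1r col_char_row addr0.
  by rewrite cfdotZr col_char_orthogonal // mulr0.
have i_col : i \in irr_constt col_char.
  rewrite irr_consttE; apply: contra_eq_neq frob_col => o_i.
  by rewrite frobE cfdotZr o_i mulr0 eq_sym oner_eq0.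
have i_row : i \in irr_constt (permchar n exponent 1%g).
  have := cfnorm_irr i; rewrite irr_consttE; apply: contra_eq_neq => o_i.
  have -> : '['chi_i] = '[(-1) ^+ b *: frobenius_char n exponent, 'chi_i].
    by rewrite frobE scalerA -signr_addb addbb scale1r.
  rewrite cfdotZl cfdot_suml big1 ?mulr0 1?eq_sym ?oner_eq0 // => s _; rewrite cfdotZl.
  have [->|ne_s1] := eqVneq s 1%g; first by rewrite o_i mulr0.
  apply/eqP; rewrite mulf_eq0 signr_eq0 /=; apply/negPn/negP => s_i.
  have := constt_ortho_char col_char_char (psi_char s) i_col _ (col_char_orthogonal ne_s1).
  by move/(_ i); rewrite irr_consttE cfnorm_irr => /(_ s_i) /eqP; rewrite oner_eq0.
exists b; rewrite frobE; congr (_ *: _); rewrite /sym_chi; congr ('chi_ _).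
rewrite /sym_Iirr -permchar_row -/col_char; case: pickP => [j /andP[j_row j_col]|/(_ i)];
  last first.
  by rewrite i_row i_col.
apply/eqP/negPn/negP => ne_ij.
have /(constt_charP _ col_char_char)[phi phi_char colE] := i_col.
have j_phi : j \in irr_constt phi.
  rewrite irr_consttE; have : '[col_char, 'chi_j] != 0 by rewrite -irr_consttE.
  by rewrite colE cfdotDl cfdot_irr (negPf ne_ij) add0r.
have o_phi : '[phi, permchar n exponent 1%g] = 0.
  have := col_char_row; rewrite colE cfdotDl cfdotC_char ?irr_char //.
  have := i_row; rewrite irr_consttE.
  have /natrP[m ->] := Cnat_cfdot_char_irr i (psi_char 1%g).
  have /natrP[m' ->] := Cnat_cfdot_char phi_char (psi_char 1%g).
  rewrite pnatr_eq0 -natrD => m0 /eqP; rewrite pnatr_eq1 => mm.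
  by apply/eqP; rewrite pnatr_eq0; lia.
have := constt_ortho_char phi_char (psi_char 1%g) j_phi j_row o_phi.
by rewrite cfnorm_irr => /eqP; rewrite oner_eq0.
Qed.
End Shape.

(** * Cycles *)
Section Cycle.
Variables (k m : nat).
Local Notation n := (k.+1 + m)%N.
Local Notation lo x := (lshift m x : 'I_n).
Local Notation hi x := (rshift k.+1 x : 'I_n).

Definition cycle_fun (x : 'I_n) : 'I_n :=
  match split x with inl y => lo (ordS y) | inr y => hi y end.

Lemma cycle_fun_inj : injective cycle_fun.
Proof.
move=> x y; rewrite /cycle_fun -[x]splitK -[y]splitK !unsplitK.
case: (split x) => x'; case: (split y) => y' //.
- by move/lshift_inj/ordS_inj->.
- by move/eqP; rewrite eq_lrshift.
- by move/eqP; rewrite eq_rlshift.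
Qed.

Definition cycle_perm : 'S_n := perm cycle_fun_inj.

Lemma cycle_permL x : cycle_perm (lo x) = lo (ordS x).
Proof. by rewrite permE /cycle_fun -/(unsplit (inl x)) unsplitK. Qed.
Lemma cycle_permR x : cycle_perm (hi x) = hi x.
Proof. by rewrite permE /cycle_fun -/(unsplit (inr x)) unsplitK. Qed.

Lemma cycle_perm_iter (x : 'I_k.+1) : lo x = (cycle_perm ^+ x)%g (lo ord0).
Proof.
case: x => i; elim: i => [|i IHi] lt_i.
  by rewrite expg0 perm1; congr (lo _); apply: val_inj.
rewrite expgSr permM -(IHi (ltnW lt_i)) cycle_permL; congr (lo _).
by apply: val_inj; rewrite /= modn_small.
Qed.

Lemma cycle_perm_fixed (T : finType) (F : {ffun 'I_n -> T}) :
  (pact cycle_perm F == F) = const_on k.+1 F.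
Proof.
apply/eqP/forallP => [fixF x|constF].
  have F0 (y : 'I_k.+1) : F (lo y) = F (lo ord0).
    rewrite cycle_perm_iter; elim: (y : nat) => [|i IHi]; first by rewrite expg0 perm1.
    by rewrite -[RHS]IHi expgSr permM -[in RHS]fixF ffunE.
  apply/forallP => y; apply/implyP; rewrite -[x]splitK -[y]splitK.
  have hiF (z : 'I_m) : (hi z < k.+1)%N = false by rewrite ltnNge leq_addr.
  case: (split x) => x'; rewrite ?hiF //; case: (split y) => y'; rewrite ?hiF ?andbF //.
  by rewrite !F0.
apply/ffunP => x; rewrite ffunE -[x]splitK; case: (split x) => x' /=;
  last by rewrite cycle_permR.
rewrite cycle_permL; apply/eqP; move/forallP/(_ (lo x'))/implyP: (constF (lo (ordS x'))); apply.
by rewrite /= ltn_pmod //=; case: (x).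
Qed.

Lemma cycle_perm_type : has_cycle_type cycle_perm (k.+1 :: nseq m 1%N).
Proof.
pose A : {set 'I_n} := [set lo x | x in 'I_k.+1].
pose Bs : {set {set 'I_n}} := [set [set hi x] | x in 'I_m].
have porbL x : porbit cycle_perm (lo x) = A.
  have -> : porbit cycle_perm (lo x) = porbit cycle_perm (lo ord0).
    by rewrite cycle_perm_iter; apply/eqP; rewrite eq_porbit_mem; apply: mem_porbit.
  apply/setP => y; apply/porbitP/imsetP => [[i ->]|[z _ ->]]; last by exists z;
    apply: cycle_perm_iter.
  elim: i => [|i [z _ IHi]]; first by exists ord0; rewrite ?expg0 ?perm1.
  by exists (ordS z); rewrite // expgSr permM IHi cycle_permL.
have porbR x : porbit cycle_perm (hi x) = [set hi x].
  apply/setP => y; rewrite inE; apply/porbitP/eqP => [[i ->]|->]; last by exists 0%N;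
    rewrite expg0 perm1.
  by elim: i => [|i IHi]; rewrite ?expg0 ?perm1 // expgSr permM IHi cycle_permR.
have porbE : porbits cycle_perm = A |: Bs.
  apply/setP => P; rewrite !inE; apply/imsetP/orP => [[x _ ->]|[/eqP->|/imsetP[x _ ->]]].
  - rewrite -[x]splitK; case: (split x) => y /=; first by left; rewrite porbL.
    by right; rewrite porbR imset_f.
  - by exists (lo ord0).
  - by exists (hi x).
have A_Bs : A \notin Bs.
  apply/imsetP => -[x _ AE]; have : lo ord0 \in A by apply: imset_f.
  by rewrite AE inE eq_lrshift.
have card_A : #|A| = k.+1 by rewrite card_imset ?card_ord //; apply: lshift_inj.
have card_Bs : #|Bs| = m.
  by rewrite card_imset ?card_ord // => x y /set1_inj/rshift_inj.
rewrite /has_cycle_type porbE.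
have perm_enum : perm_eq (enum (A |: Bs)) (A :: enum Bs).
  apply: uniq_perm; rewrite /= ?enum_uniq ?mem_enum ?A_Bs // => P.
  by rewrite inE !mem_enum !inE.
rewrite (perm_trans (perm_map _ perm_enum)) //= card_A.
have -> : [seq #|X| | X : {set 'I_n} <- enum Bs] = nseq m 1%N; last exact: perm_refl.
pose cards := [seq #|X| | X : {set 'I_n} <- enum Bs].
transitivity (nseq (size cards) 1%N); last by rewrite size_map -cardE card_Bs.
apply/all_pred1P/allP => c /mapP[P]; rewrite mem_enum => /imsetP[x _ ->] ->.
by rewrite /= cards1.
Qed.
End Cycle.

(** * The character ratio *)
Section Ratio.
Variables (L : nat).
Implicit Types a b : 'I_L -> nat.

Definition content_sum m a : algC :=
  \sum_(s : 'S_L) (-1) ^+ s * #|[set F : {ffun 'I_m -> 'I_L} | has_content a s F]|%:R.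

Definition ffact_mx a : 'M[algC]_L := \matrix_(i, j) (a i ^_ rev_ord j)%:R.

Lemma card_has_content m a (s : 'S_L) : (\sum_i a i = m + \sum_(i < L) rev_ord i)%N ->
  (#|[set F : {ffun 'I_m -> 'I_L} | has_content a s F]| * \prod_i (a i)`!
     = m`! * \prod_i (a i ^_ rev_ord (s i)))%N.
Proof.
move=> a_sum; case: (boolP [forall i, rev_ord (s i) <= a i]%N) => [/forallP le_a|/forallPn[i]].
  rewrite -(@card_words_of_content _ m (fun i => a i - rev_ord (s i))%N).
    rewrite -mulnA -big_split; congr (_ * _)%N.
      apply: eq_card => F; rewrite !inE; apply: eq_forallb => i.
      by rewrite -[RHS](eqn_add2r (rev_ord (s i))) subnK.
    by apply: eq_bigr => i _; rewrite -(ffact_fact (le_a i)) mulnC.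
  apply: (@addIn (\sum_(i < L) rev_ord (s i))%N); rewrite -big_split /=.
  transitivity (\sum_i a i)%N; first by apply: eq_bigr => i _; exact: subnK (le_a i).
  by rewrite a_sum; congr (_ + _)%N; apply: reindex_inj; apply: perm_inj.
rewrite -ltnNge => lt_a; rewrite [X in #|pred_of_set X|](_ : _ = set0); last first.
  apply/setP => F; rewrite !inE; apply/negbTE/forallPn; exists i.
  by rewrite neq_ltn orbC (leq_trans lt_a) ?leq_addl.
by rewrite cards0 [X in _ = (_ * X)%N](bigD1 i) //= ffact_small // !muln0.
Qed.

Lemma content_sumE m a : (\sum_i a i = m + \sum_(i < L) rev_ord i)%N ->
  content_sum m a * (\prod_i (a i)`!)%:R = (m`!)%:R * \det (ffact_mx a).
Proof.
move=> a_sum; rewrite mulr_suml mulr_sumr; apply: eq_bigr => s _.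
rewrite -mulrA -natrM card_has_content // natrM mulrCA; congr (_ * (_ * _)).
by rewrite natr_prod; apply: eq_bigr => i _; rewrite mxE.
Qed.

Lemma frobenius_1 n a : frobenius_char n a 1%g = content_sum n a.
Proof.
rewrite sum_cfunE; apply: eq_bigr => s _; rewrite cfunE permcharE; congr (_ * _%:R).
by apply: eq_card => F; rewrite !inE pact1 eqxx.
Qed.

Definition lower k a (t : 'I_L) : 'I_L -> nat := fun i => (a i - k * (t == i))%N.

(** A word fixed by the cycle has one letter t on its support, and what remains is
    a word whose content is lowered at t. *)
Lemma frobenius_cycle k m a :
  frobenius_char (k.+1 + m) a (cycle_perm k m) =
    \sum_(t | (k < a t)%N) content_sum m (lower k.+1 a t).
Proof.
rewrite sum_cfunE /content_sum exchange_big /=; apply: eq_bigr => s _.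
rewrite cfunE permcharE -mulr_sumr -natr_sum; congr (_ * _%:R).
have contE n (F : {ffun 'I_n -> 'I_L}) : has_content a s F =
    [forall i, rev_ord (s i) <= a i]%N && [forall i, occ F i == a i - rev_ord (s i)]%N.
  apply/forallP/andP => [H|[/forallP le_a /forallP H] i]; last by rewrite (eqP (H i)) subnK.
  by split; apply/forallP => i; rewrite -(eqP (H i)) ?leq_addl ?addnK.
transitivity (\sum_t #|[set F : {ffun 'I_m -> 'I_L} |
    [forall i, rev_ord (s i) <= a i]%N && [forall i, occ F i + k.+1 * (t == i) == a i - rev_ord (s i)]%N]|)%N.
  case: (boolP [forall i, rev_ord (s i) <= a i]%N) => le_a; last first.
    rewrite big1 => [|t _]; apply/eqP; rewrite cards_eq0; apply/eqP/setP => F;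
      rewrite !inE ?contE ?(negPf le_a) ?andbF //.
  rewrite -card_const_on; apply: eq_card => F; rewrite !inE cycle_perm_fixed contE le_a //.
rewrite [RHS]big_mkcond; apply: eq_bigr => t _; case: ltnP => [lt_kt|le_tk]; last first.
  apply/eqP; rewrite cards_eq0; apply/eqP/setP => F; rewrite !inE;
    apply/negbTE/andP => -[_ /forallP/(_ t)].
  rewrite eqxx muln1; apply/negP; rewrite neq_ltn orbC.
  by rewrite (leq_ltn_trans (leq_subr _ _)) // (leq_trans _ (leq_addl _ _)).
apply: eq_card => F; rewrite !inE.
apply/andP/forallP => [[/forallP le_a /forallP H] i|H].
  rewrite /lower -(eqn_add2r (k.+1 * (t == i))) addnAC (eqP (H i)) !subnK //.
  by case: eqP => [<-|_]; rewrite ?muln1 ?muln0.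
have aE i : a i = (occ F i + rev_ord (s i) + k.+1 * (t == i))%N.
  rewrite (eqP (H i)) subnK //.
  by case: eqP => [<-|_]; rewrite ?muln1 ?muln0.
by split; apply/forallP => i; rewrite aE addnAC ?leq_addl ?addnK.
Qed.

Definition ffact_poly d : {poly algC} := \prod_(j < d) ('X - j%:R%:P).

Lemma ffact_polyE d n : (ffact_poly d).[n%:R] = (n ^_ d)%:R.
Proof.
elim: d => [|d IHd]; first by rewrite /ffact_poly big_ord0 hornerC.
rewrite /ffact_poly big_ord_recr hornerM -/(ffact_poly d) IHd hornerXsubC ffactnSr natrM.
case: (leqP d n) => [le_dn|lt_nd]; first by rewrite natrB.
by rewrite ffact_small ?mul0r.
Qed.

Lemma size_ffact_poly d : size (ffact_poly d) = d.+1.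
Proof.
rewrite /ffact_poly -(big_mkord xpredT (fun j => 'X - j%:R%:P)) -(big_map (fun j => j%:R) xpredT (fun c => 'X - c%:P)).
by rewrite size_prod_XsubC size_map size_iota subn0.
Qed.

(** As a polynomial in the value y of the entry t of a, the determinant has degree
    below L and vanishes when y is another entry; so it is the determinant at a
    times the Lagrange interpolation polynomial of the node a_t. *)
Lemma ffact_mx_lower k a t : injective a -> (k <= a t)%N ->
  \det (ffact_mx (lower k a t)) = \det (ffact_mx a) *
    \prod_(j | j != t) (((a t)%:R - k%:R - (a j)%:R) / ((a t)%:R - (a j)%:R)).
Proof.
move=> a_inj le_k.
(* The matrix at a with the entry t of a replaced by an indeterminate. *)
pose PM : 'M[{poly algC}]_L := \matrix_(i, j)
  if i == t then ffact_poly (rev_ord j) else ((a i ^_ rev_ord j)%:R)%:P.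
have PM_eval y : (\det PM).[y%:R] = \det (ffact_mx (fun i => if i == t then y else a i)).
  rewrite -[LHS]/(horner_eval y%:R (\det PM)) -det_map_mx; congr (\det _).
  apply/matrixP => i j; rewrite !mxE; case: eqP => _; last exact: hornerC.
  exact: ffact_polyE.
pose d := \prod_(j | j != t) ((a t)%:R - (a j)%:R : algC).
have d_neq0 : d != 0.
  by apply/prodf_neq0 => j ne_jt; rewrite subr_eq0 eqr_nat (inj_eq a_inj) eq_sym.
pose q : {poly algC} := (\det (ffact_mx a) / d) *: \prod_(j | j != t) ('X - ((a j)%:R)%:P).
have q_eval y : q.[y] = \det (ffact_mx a) / d * \prod_(j | j != t) (y - (a j)%:R).
  by rewrite hornerZ horner_prod; congr (_ * _); apply: eq_bigr => j _; rewrite hornerXsubC.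
have a_t : ffact_mx (fun i => if i == t then a t else a i) = ffact_mx a.
  by apply/matrixP => i j; rewrite !mxE; case: eqP => // ->.
have size_PM : (size (\det PM) <= L)%N.
  rewrite (leq_trans (size_sum _ _ _)) //; apply/bigmax_leqP => s _.
  rewrite -(rmorph_sign (@polyC algC)) mul_polyC (leq_trans (size_scale_leq _ _)) //.
  rewrite (bigD1 t) //= mxE eqxx (eq_bigr (fun i => ((a i ^_ rev_ord (s i))%:R)%:P));
    last first.
    by move=> i /negPf ne_it; rewrite mxE ne_it.
  rewrite -rmorph_prod mulrC mul_polyC (leq_trans (size_scale_leq _ _)) //.
  by rewrite size_ffact_poly; case: (rev_ord (s t)).
have size_q : (size q <= L)%N.
  rewrite (leq_trans (size_scale_leq _ _)) // -big_filter.
  rewrite -(big_map (fun j => (a j)%:R) xpredT (fun c => 'X - c%:P)) size_prod_XsubC size_map.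
  rewrite -[X in (_ <= X)%N]card_ord (cardD1 t) inE add1n ltnS.
  rewrite -sum1_size big_filter -sum1_card leq_eqVlt; apply/orP; left; apply/eqP.
  by apply: eq_bigl => j; rewrite !inE andbT.
have PMq : \det PM - q = 0.
  apply: (@roots_geq_poly_eq0 _ _ [seq (a i)%:R | i <- enum 'I_L]).
  - apply/allP => _ /mapP[i _ ->]; rewrite /root hornerD hornerN PM_eval q_eval subr_eq0;
    apply/eqP.
    have [->|ne_it] := eqVneq i t; first by rewrite a_t divfK.
    rewrite [X in _ = _ * X](bigD1 i) //= subrr mul0r mulr0.
    by apply: (determinant_alternate ne_it) => j; rewrite !mxE eqxx (negPf ne_it).
  - by rewrite map_inj_uniq ?enum_uniq // => i j /eqP; rewrite eqr_nat => /eqP/a_inj.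
  - rewrite size_map size_enum_ord (leq_trans (size_polyD _ _)) // size_polyN.
    by rewrite geq_max size_PM.
have := PM_eval (a t - k)%N; move/eqP: PMq; rewrite subr_eq0 => /eqP->.
rewrite q_eval => e; transitivity (\det (ffact_mx (fun i => if i == t then (a t - k)%N else a i))).
  congr (\det _); apply/matrixP => i j; rewrite !mxE /lower eq_sym.
  by case: eqP => [->|_]; rewrite ?muln1 ?muln0 ?subn0.
by rewrite -e natrB // -mulrA [X in _ * X]mulrC prodf_div.
Qed.

Lemma sum_lower k m a t : (k <= a t)%N -> (\sum_i a i = k + m + \sum_(i < L) rev_ord i)%N ->
  (\sum_i lower k a t i = m + \sum_(i < L) rev_ord i)%N.
Proof.
move=> le_k a_sum; apply: (@addnI k); rewrite addnA -a_sum.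
rewrite (bigD1 t) //= [RHS](bigD1 t) //= /lower eqxx muln1 addnA subnKC //; congr (_ + _)%N.
by apply: eq_bigr => i /negPf ne; rewrite eq_sym ne muln0 subn0.
Qed.

Lemma fact_lower k a t : (k <= a t)%N ->
  (\prod_i (a i)`! = a t ^_ k * \prod_i (lower k a t i)`!)%N.
Proof.
move=> le_k; rewrite (bigD1 t) //= [in RHS](bigD1 t) //= mulnA /lower eqxx muln1 ffact_fact //.
by congr (_ * _)%N; apply: eq_bigr => i /negPf ne; rewrite eq_sym ne muln0 subn0.
Qed.

Lemma frobenius_ratio k m a : injective a ->
    (\sum_i a i = k.+1 + m + \sum_(i < L) rev_ord i)%N ->
    frobenius_char (k.+1 + m) a 1%g != 0 ->
  ((k.+1 + m) ^_ k.+1)%:R * frobenius_char (k.+1 + m) a (cycle_perm k m) / frobenius_char (k.+1 + m) a 1%g =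
  \sum_t (a t ^_ k.+1)%:R *
    \prod_(j | j != t) (((a t)%:R - k.+1%:R - (a j)%:R) / ((a t)%:R - (a j)%:R)).
Proof.
move=> a_inj a_sum nz1; pose Q := (\prod_i (a i)`!)%:R : algC.
have Q_neq0 : Q != 0 by rewrite pnatr_eq0 -lt0n prodn_gt0 // => i; apply: fact_gt0.
have one := content_sumE a_sum; rewrite -frobenius_1 -/Q in one.
have nz_det : \det (ffact_mx a) != 0.
  apply: contraNneq nz1 => det0; rewrite det0 mulr0 in one.
  by move/eqP: one; rewrite mulf_eq0 (negPf Q_neq0) orbF.
have cyc : frobenius_char (k.+1 + m) a (cycle_perm k m) * Q =
    (m`!)%:R * \det (ffact_mx a) * \sum_t (a t ^_ k.+1)%:R *
      \prod_(j | j != t) (((a t)%:R - k.+1%:R - (a j)%:R) / ((a t)%:R - (a j)%:R)).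
  rewrite frobenius_cycle mulr_suml mulr_sumr big_mkcond; apply: eq_bigr => t _.
  case: ltnP => [lt_k|le_k]; last by rewrite ffact_small // mul0r mulr0.
  rewrite /Q (fact_lower lt_k) natrM mulrCA content_sumE; last exact: sum_lower.
  by rewrite (ffact_mx_lower a_inj lt_k); ring.
apply: (mulIf nz1); rewrite divfK //; apply: (mulIf Q_neq0).
rewrite -[LHS]mulrA cyc -[RHS]mulrA one -(ffact_fact (leq_addr m k.+1)) addKn natrM.
by ring.
Qed.
End Ratio.

(** * Naturality and homogeneity of the Kerov series *)

Section Transfer.
Variables (A B : comAlgType rat) (phi : {rmorphism A -> B}) (N : nat).
Variables (R : nat -> A) (R' : nat -> B).
Hypothesis phiR : forall i, (2 <= i <= N)%N -> phi (R i) = R' i.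

Definition agrees (f : fps A) (g : fps B) := forall n, (n <= N)%N -> phi (f n) = g n.

Lemma rmorphZ_rat (q : rat) (x : A) : phi (q *: x) = q *: phi x.
Proof.
have d_neq0 : (denq q)%:~R != 0 :> rat by rewrite intr_eq0 denq_neq0.
have phiZ (z : int) y : phi (z%:~R *: y) = z%:~R *: phi y.
  by rewrite !scaler_int rmorphMz.
apply: (can_inj (scalerK d_neq0)); rewrite -phiZ !scalerA mulrC -numqE phiZ.
by [].
Qed.
Lemma agrees1 : agrees 1 1.
Proof. by move=> n _; rewrite !fps1 rmorph_nat. Qed.

Lemma agreesM f f' g g' : agrees f f' -> agrees g g' -> agrees (f * g) (f' * g').
Proof.
move=> ff gg n le_n; rewrite !fpsM rmorph_sum; apply: eq_bigr => i _.
have le_i : (i <= n)%N by rewrite -ltnS.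
by rewrite rmorphM ff ?gg // ?(leq_trans le_i) // (leq_trans (leq_subr _ _)).
Qed.

Lemma agrees_inv f f' : agrees f f' -> agrees (fps_inv f) (fps_inv f').
Proof.
move=> ff n le_n; rewrite /fps_inv rmorph_sum; apply: eq_bigr => m _; rewrite !fps_expE.
move: (nat_of_ord m) => {}m; elim: m n le_n => [|m IHm] n le_n; first by rewrite agrees1.
rewrite !exprS; apply: (agreesM _ IHm) => // i le_i.
by rewrite rmorphB ff // (agrees1 le_i).
Qed.

Lemma agrees_C : agrees (C_series R) (C_series R').
Proof.
apply: agrees_inv => n le_n; rewrite rmorphB (agrees1 le_n); congr (_ - _).
by case: leqP => // lt_n; rewrite ?rmorph0 // rmorphMn phiR ?lt_n.
Qed.

Lemma agrees_PQ m : agrees (PQ_series R m) (PQ_series R' m).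
Proof.
elim: m => [|[|m] IHm]; [exact: agrees1 | exact: agrees_C |].
apply: agreesM agrees_C _ => n le_n.
by rewrite /fps_DI rmorphD !rmorphMn IHm.
Qed.

Lemma agrees_P_factor j : agrees (P_factor R j) (P_factor R' j).
Proof.
move=> n le_n; rewrite rmorphD (agrees1 le_n) /fps_sum1 rmorph_sum; congr (_ + _).
apply: eq_big_nat => i _; rewrite rmorphMn rmorphZ_rat agrees_PQ //.
by rewrite (leq_trans (leq_subr _ _)).
Qed.

Lemma agrees_kerov_series k : agrees (kerov_series R k) (kerov_series R' k).
Proof.
apply: agreesM (agrees_inv agrees_C) _; apply: (big_ind2 agrees).
- exact: agrees1.
- by move=> f f' g g'; apply: agreesM.
- by move=> j _; apply: agrees_P_factor.
Qed.
End Transfer.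

Section Scaling.
Variables (A : comAlgType rat) (R : nat -> A) (c : rat).
Hypothesis c_neq0 : c != 0.

Definition scaled (f : fps A) (g : fps {poly A}) := forall n, f n = c ^+ n *: (g n).[c^-1%:A].

Let R' i := c ^+ i *: R i.

Definition dilated (f g : fps A) := forall n, f n = c ^+ n *: g n.

Lemma dilatedM f f' g g' : dilated f f' -> dilated g g' -> dilated (f * g) (f' * g').
Proof.
move=> ff gg n; rewrite !fpsM scaler_sumr; apply: eq_bigr => i _.
have le_i : (i <= n)%N by rewrite -ltnS.
by rewrite ff gg -scalerAl -scalerAr scalerA -exprD subnKC.
Qed.

Lemma dilated1 : dilated 1 1.
Proof. by move=> [|n]; rewrite fps1 ?scale1r ?scaler0. Qed.

Lemma dilated_inv f g : dilated f g -> dilated (fps_inv f) (fps_inv g).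
Proof.
move=> fg n; rewrite /fps_inv scaler_sumr; apply: eq_bigr => m _; rewrite !fps_expE.
move: (nat_of_ord m) => {}m; elim: m n => [|m IHm]; first exact: dilated1.
by rewrite !exprS; apply: dilatedM => // n; rewrite scalerBr -fg -dilated1.
Qed.

Lemma dilated_C : dilated (C_series R') (C_series R).
Proof.
apply: dilated_inv => n; rewrite scalerBr; congr (_ - _); first exact: dilated1.
by case: ifP => _; rewrite ?scaler0 // scalerMnr.
Qed.

Lemma dilated_PQ m : dilated (PQ_series R' m) (PQ_series R m).
Proof.
elim: m => [|[|m] IHm]; [exact: dilated1 | exact: dilated_C |].
rewrite -[PQ_series R' _]/(C_series R' * fps_DI m (PQ_series R' m.+1)).
rewrite -[PQ_series R _]/(C_series R * fps_DI m (PQ_series R m.+1)).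
by apply: dilatedM dilated_C _ => n; rewrite /fps_DI scalerDr -!scalerMnr !IHm.
Qed.

Lemma scaled1 : scaled 1 1.
Proof.
by move=> n; rewrite !fps1 -(rmorph_nat (@polyC A)) hornerC; case: n => [|n];
  rewrite ?scale1r ?scaler0.
Qed.

Lemma scaledM f f' g g' : scaled f f' -> scaled g g' -> scaled (f * g) (f' * g').
Proof.
move=> ff gg n; rewrite !fpsM horner_sum scaler_sumr; apply: eq_bigr => i _.
have le_i : (i <= n)%N by rewrite -ltnS.
by rewrite ff gg hornerM -scalerAl -scalerAr scalerA -exprD subnKC.
Qed.

Lemma scaled_P_factor j : scaled (P_factor R' j) (P_factor_u R j).
Proof.
move=> n; rewrite hornerD scalerDr -scaled1; congr (_ + _).
rewrite /fps_sum1 horner_sum scaler_sumr; apply: eq_big_nat => i /andP[_ le_in].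
have PE : P_series R' i (n - i)%N = c ^+ (n - i) *: P_series R i (n - i)%N.
  by rewrite /P_series dilated_PQ !scalerA mulrC.
rewrite hornerZ hornerXn exprZn expr1n mulr_algr scalerA PE scalerMnr; congr (_ *: _).
by rewrite exprVn expfB_cond // (negPf c_neq0).
Qed.

Lemma scaled_kerov_series k : scaled (kerov_series R' k) (kerov_series_u R k).
Proof.
apply: scaledM.
  by move=> n; rewrite hornerC; apply: dilated_inv; apply: dilated_C.
apply: (big_ind2 scaled); [exact: scaled1 | by move=> f f' g g'; apply: scaledM |].
by move=> j _; apply: scaled_P_factor.
Qed.
End Scaling.

(** * Character values as residues *)

Lemma map_lin (A B : comNzRingType) (phi : {rmorphism A -> B}) c :
  map_fps phi (lin_factor c) = lin_factor (phi c).
Proof. by rewrite rmorphB rmorph1 rmorphM /= map_fpsC map_fpsX. Qed.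

Lemma map_cumulant_eq (A B : comNzRingType) (phi : {rmorphism A -> B}) L (u : 'I_L -> A)
    (R : fps A) : cumulant_eq u R -> cumulant_eq (phi \o u) (map_fps phi R).
Proof.
have termE c : map_fps phi (R - fpsC c * fps_X A) =
    map_fps phi R - fpsC (phi c) * fps_X B.
  by rewrite rmorphB rmorphM /= map_fpsC map_fpsX.
move/(congr1 (map_fps phi)); rewrite rmorphM !rmorph_prod /= termE rmorphN rmorph_nat => H.
rewrite /cumulant_eq; transitivity (\prod_i map_fps phi (R - fpsC (u i) * fps_X A)).
  by rewrite -H; congr (_ * _); apply: eq_bigr => i _; rewrite termE (rmorphD phi) rmorph1.
by apply: eq_bigr => i _; rewrite termE.
Qed.

Lemma cycle_ratio_exists n k m L (a : 'I_L -> nat) : n = (k.+1 + m)%N -> injective a ->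
    (\sum_i a i = n + \sum_(i < L) rev_ord i)%N ->
  exists s : 'S_n, has_cycle_type s (k.+1 :: nseq m 1%N) /\ (frobenius_char n a 1%g != 0 ->
  (n ^_ k.+1)%:R * frobenius_char n a s / frobenius_char n a 1%g =
  \sum_t (a t ^_ k.+1)%:R *
    \prod_(j | j != t) (((a t)%:R - k.+1%:R - (a j)%:R) / ((a t)%:R - (a j)%:R))).
Proof.
move=> -> a_inj a_sum; exists (cycle_perm k m); split; first exact: cycle_perm_type.
exact: frobenius_ratio.
Qed.

(** The sum over t is a sum of residues, the factor - k - 1 being the difference
    u_t - (u_t + k + 1) of the term t with itself. *)
Lemma residue_ratio k L (u : 'I_L -> algC) (a : 'I_L -> nat) : (0 < L)%N ->
    (forall i, (a i)%:R = u i + L%:R) -> injective a ->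
  (\prod_(j < k.+1) shift j (profile_series u)) k.+2 = - k.+1%:R *
  \sum_t (a t ^_ k.+1)%:R *
    \prod_(j | j != t) (((a t)%:R - k.+1%:R - (a j)%:R) / ((a t)%:R - (a j)%:R)).
Proof.
move=> L_gt0 au a_inj.
have u_inj : injective u.
  by move=> i j /(congr1 (+%R^~ L%:R)) /eqP; rewrite -!au eqr_nat => /eqP/a_inj.
pose s := [seq j%:R - L%:R | j <- iota 0 k.+1] ++ [seq u i + k.+1%:R | i <- enum 'I_L].
have -> : \prod_(j < k.+1) shift j (profile_series u) = \prod_(c <- s) lin_factor c * \prod_i fps_inv (lin_factor (u i)).
  rewrite prod_shift_profile_series big_split /= mulrA big_cat !big_map -?enumT ?big_enum /=.
  by rewrite -(big_mkord xpredT (fun j => lin_factor (j%:R - L%:R))) /index_iota subn0.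
rewrite (residue_sum u_inj) //; last first.
  by rewrite size_cat !size_map size_iota -?enumT size_enum_ord addSn.
rewrite mulr_sumr; apply: eq_bigr => t _.
have -> : \prod_(c <- s) (u t - c) = (a t ^_ k.+1)%:R * (- k.+1%:R *
    \prod_(j | j != t) ((a t)%:R - k.+1%:R - (a j)%:R)).
  rewrite big_cat !big_map -?enumT ?big_enum /=; congr (_ * _).
    rewrite -ffact_polyE horner_prod -(big_mkord xpredT (fun j => ('X - j%:R%:P).[(a t)%:R])).
    by rewrite /index_iota subn0; apply: eq_bigr => j _; rewrite hornerXsubC au; ring.
  rewrite (bigD1 t) //=; congr (_ * _); first by ring.
  by apply: eq_bigr => j _; rewrite !au; ring.
rewrite prodf_div [X in _ / X](eq_bigr (fun j => (a t)%:R - (a j)%:R)) => [|j _]; last first.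
  by rewrite !au; ring.
by ring.
Qed.

Lemma partition_residue w k m : is_partition w -> sumn w = (k.+1 + m)%N ->
  exists s : 'S_(sumn w), has_cycle_type s (k.+1 :: nseq m 1%N) /\
  (sumn w ^_ k.+1)%:R * sym_chi w s / sym_chi w 1%g =
   - (k.+1%:R^-1) * (\prod_(j < k.+1) shift j (profile_series (fun i : 'I_(size w) =>
       (nth 0%N w i)%:R - i.+1%:R))) k.+2.
Proof.
move=> w_part w_sum; have [b frobE] := frobenius_sym_chi w_part.
have a_inj := exponent_inj w_part.
have [s [s_type s_val]] := cycle_ratio_exists w_sum a_inj (exponent_sum w).
exists s; split=> //; have chi1 : sym_chi w 1%g != 0 by apply: irr1_neq0.
have sgn0 : (-1) ^+ b != 0 :> algC by rewrite signr_eq0.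
have frob1 : frobenius_char (sumn w) (@exponent w) 1%g != 0.
  by rewrite frobE cfunE mulf_neq0.
have L_gt0 : (0 < size w)%N by case: (w) w_sum.
rewrite (@residue_ratio _ _ _ (@exponent w)) //; last first.
  move=> i; rewrite /exponent natrD /= natrB ?ltn_ord //; ring.
rewrite -s_val // frobE !cfunE mulrA mulNr mulrN opprK mulVf ?mul1r ?pnatr_eq0 //.
by move: ((-1) ^+ b) sgn0 (sym_chi w s) (sym_chi w 1%g) chi1 => e e0 x y y0; field;
  rewrite e0 y0.
Qed.

Section StrictShape.
Variables (k : nat) (v : 'I_k.+1 -> nat).
Hypothesis v_lt : forall i j : 'I_k.+1, (i < j)%N -> (v j < v i)%N.
Hypothesis v_gt0 : forall i, (0 < v i)%N.
Local Notation K := k.+1.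

Definition shape : seq nat := [seq v i | i <- enum 'I_K].
Definition content (i : 'I_K) : algC := (v i)%:R - i.+1%:R.

Lemma size_shape : size shape = K. Proof. by rewrite size_map size_enum_ord. Qed.

Lemma nth_shape (i : 'I_K) : nth 0%N shape i = v i.
Proof. by rewrite (nth_map ord0) ?size_enum_ord // nth_ord_enum. Qed.

Lemma nth_shape_ord j : (j < K)%N -> nth 0%N shape j = v (inord j).
Proof. by move=> lt_j; rewrite -nth_shape inordK. Qed.

Lemma shape_lt i : (i < K)%N -> (nth 0%N shape i.+1 < nth 0%N shape i)%N.
Proof.
move=> lt_i; rewrite [X in (_ < X)%N]nth_shape_ord //; case: (ltnP i.+1 K) => [lt_i1|le_Ki].
  by rewrite nth_shape_ord // v_lt // !inordK.
by rewrite nth_default ?size_shape.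
Qed.

Lemma shape_partition : is_partition shape.
Proof.
apply/andP; split; last by apply/mapP => -[i _ v0]; have := v_gt0 i; rewrite -v0.
apply/(sortedP 0%N) => i; rewrite size_shape => /ltnW/shape_lt/ltnW; exact.
Qed.

Lemma sumn_shape_ge : (K <= sumn shape)%N.
Proof.
rewrite sumnE big_map big_enum /= -[X in (X <= _)%N]card_ord -sum1_card.
exact: leq_sum.
Qed.

Lemma big_iota_ord (A : comNzRingType) (F : nat -> A) : \prod_(i <- iota 0 K) F i = \prod_(i < K) F i.
Proof. by rewrite -(big_mkord xpredT F) /index_iota subn0. Qed.

Lemma H_seriesE : H_series shape = fps_X algC *
  (\prod_i lin_factor (content i) * (\prod_i fps_inv (lin_factor (content i + 1)) * fps_inv (lin_factor (- K%:R)))).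
Proof.
have linE c : fps_sub (fps_one algC) (fps_scale c (fps_X algC)) = lin_factor c.
  by rewrite /lin_factor fps_scaleE.
rewrite /H_series fps_mulE !fps_bigE; congr (_ * (_ * _)).
  rewrite /removable_contents size_shape big_map big_filter.
  rewrite big_seq_cond (eq_bigl (fun i => i \in iota 0 K)) => [|i]; last first.
    by rewrite mem_iota add0n; case: ltnP => //= lt_i; rewrite shape_lt.
  rewrite -big_seq big_iota_ord; apply: eq_bigr => i _; rewrite linE; congr (lin_factor _).
  by rewrite nth_shape /content !rmorphB /= -!pmulrn -natr1 opprD addrA addrAC.
rewrite /addable_contents size_shape big_map big_filter.
rewrite big_seq_cond (eq_bigl (fun i => i \in iota 0 K.+1)) => [|i]; last first.
  rewrite mem_iota add0n; case: ltnP => //= lt_i.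
  by case: i lt_i => //= i lt_i; rewrite shape_lt.
rewrite -big_seq -[K.+1]addn1 iotaD big_cat big_seq1 big_iota_ord; congr (_ * _).
  apply: eq_bigr => i _; rewrite linE; congr (fps_inv (lin_factor _)).
  by rewrite nth_shape /content rmorphB /= -!pmulrn -natr1 opprD addrA subrK.
by rewrite linE nth_default ?size_shape // sub0r rmorphN.
Qed.

Lemma cumulant_free (R : fps algC) : R 0%N = 1 -> cumulant_eq content R ->
  free_cumulants shape R.
Proof.
move=> R0 eqR n; have -> : (fun i : nat => if i == 0%N then 1 else R i) = R.
  by apply: fpsP => -[|i].
rewrite fps_mulE; set F := fps_X algC * fps_inv R.
have F0 : F 0%N = 0 by rewrite /F fpsM0 mul0r.
have HG : H_series shape * profile_series content = fps_X algC.
  rewrite H_seriesE /profile_series big_split /= -mulrA -[RHS]mulr1; congr (_ * _).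
  transitivity ((\prod_i lin_factor (content i) * \prod_i fps_inv (lin_factor (content i))) *
    (\prod_i lin_factor (content i + 1) * \prod_i fps_inv (lin_factor (content i + 1))) *
    (lin_factor (- K%:R) * fps_inv (lin_factor (- K%:R)))); first by ring.
  have cancel (f : 'I_K -> algC) : \prod_i lin_factor (f i) * \prod_i fps_inv (lin_factor (f i)) = 1.
    by rewrite -big_split big1 // => i _ /=; rewrite fps_mulV ?lin0.
  by rewrite !cancel fps_mulV ?lin0 // !mulr1.
have := congr1 (fun f => fps_comp f F * R) HG; rewrite fps_compM // fps_compX // -mulrA.
rewrite (mulrC (fps_comp (profile_series _) _)) profile_series_comp // mulr1 => ->.
by rewrite /F -mulrA (mulrC (fps_inv R)) fps_mulV // mulr1.
Qed.

(** In this form the profile is indexed by the ordinals below k + 1 rather than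
    by those below the size of the shape. *)
Lemma character_residue : exists s : 'S_(sumn shape),
  has_cycle_type s (K :: nseq (sumn shape - K) 1%N) /\
  (sumn shape ^_ K)%:R * sym_chi shape s / sym_chi shape 1%g =
   - (K%:R^-1) * (\prod_(j < K) shift j (profile_series content)) K.+1.
Proof.
have [s [s_type s_val]] := partition_residue shape_partition (esym (subnKC sumn_shape_ge)).
exists s; split=> //; rewrite s_val; congr (_ * _); congr ((_ : fps algC) K.+1).
apply: eq_bigr => j _; congr (shift _ _).
have GE L (f : nat -> algC) : size shape = L ->
   profile_series (fun i : 'I_(size shape) => f i) = profile_series (fun i : 'I_L => f i) by move=> ->.
rewrite (GE K (fun i => (nth 0%N shape i)%:R - i.+1%:R) size_shape).
by rewrite /profile_series; congr (_ * _); apply: eq_bigr => i _; rewrite nth_shape.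
Qed.
End StrictShape.

(** * The formula for Kerov polynomials *)

Lemma map_prod_shift (A B : comNzRingType) (phi : {rmorphism A -> B}) L (u : 'I_L -> A) k :
  map_fps phi (\prod_(j < k) shift j (profile_series u)) = \prod_(j < k) shift j (profile_series (phi \o u)).
Proof.
rewrite !prod_shift_profile_series rmorphM !rmorph_prod; congr (_ * _);
  apply: eq_bigr => i _ /=.
  by rewrite map_lin rmorphB /= !rmorph_nat.
rewrite rmorphM /= map_fps_inv ?lin0 // !map_lin rmorphD /= rmorph_nat.
by [].
Qed.

Lemma eq_profile_series (A : comNzRingType) L (u u' : 'I_L -> A) : u =1 u' -> profile_series u = profile_series u'.
Proof. by move=> uu; rewrite /profile_series; congr (_ * _); apply: eq_bigr => i _;
  rewrite uu. Qed.

Lemma eq_cumulant (A : comNzRingType) L (u u' : 'I_L -> A) R : u =1 u' ->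
  cumulant_eq u R -> cumulant_eq u' R.
Proof.
move=> uu; rewrite /cumulant_eq; under eq_bigr do rewrite uu; move=> ->.
by apply: eq_bigr => i _; rewrite uu.
Qed.

Section Main.
Variables (k : nat) (Sigma : {mpoly int[k.+1]}).
Hypothesis hSigma : is_kerov_polynomial Sigma.
Local Notation K := k.+1.

Lemma rmorph_kerov (A : comAlgType rat) (B : comNzRingType) (phi : {rmorphism A -> B}) (R : nat -> A) :
  phi (kerov_eval R Sigma) = mmap intr (fun i : 'I_K => phi (R i.+2)) Sigma.
Proof. by rewrite [LHS]rmorph_mmap; apply: eq_mmap => // z; apply: rmorph_int. Qed.

(** Both sides are polynomials in the u_i, and they agree at the contents of all
    strict partitions with k + 1 parts. *)
Lemma kerov_generic_profile (R : fps {mpoly rat[K]}) : R 0%N = 1 ->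
    cumulant_eq (fun i : 'I_K => 'X_i) R ->
  kerov_eval R Sigma = - (K%:R^-1 : rat) *: kerov_series R K K.+1.
Proof.
move=> R0 eqR; apply/eqP; rewrite -subr_eq0; apply/eqP.
apply: mpoly_eq0_of_strict => v v_lt v_gt0; set E := _ - _; set pt := fun i => _.
pose phi : {rmorphism {mpoly rat[K]} -> algC} := mmap (@ratr algC) (content v).
have phiE p : phi p = ratr p.@[pt].
  rewrite [RHS]rmorph_mmap; apply: eq_mmap => //= i.
  by rewrite /content [RHS]/= /pt rmorphB /= !rmorph_nat.
have phiX : phi \o (fun i : 'I_K => 'X_i) =1 content v.
  by move=> i; rewrite /= /phi /= mmapX mmap1U.
apply: (fmorph_inj (@ratr algC)); rewrite rmorph0; apply: etrans (esym (phiE E)) _.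
rewrite /E rmorphB rmorph_kerov.
have [s [s_type s_val]] := character_residue v_lt v_gt0.
have R'0 : map_fps phi R 0%N = 1 by rewrite /map_fps R0 rmorph1.
have eqR' : cumulant_eq (content v) (map_fps phi R).
  apply: (eq_cumulant phiX). exact: (@map_cumulant_eq _ _ phi _ _ _ eqR).
have free := cumulant_free v_lt v_gt0 R'0 eqR'.
rewrite -(hSigma (shape_partition v_lt v_gt0) (sumn_shape_ge v_gt0) free s_type) s_val.
rewrite (kerov_series_shift R0 (cumulant1 R0 eqR) (profile_series_comp R0 eqR)) //.
rewrite [phi (_ *: _)]mmapZ rmorphN fmorphV rmorph_nat.
have -> : mmap ratr (content v) ((\prod_(j < K) shift j (profile_series (fun i : 'I_K => 'X_i))) K.+1)
   = (\prod_(j < K) shift j (profile_series (content v))) K.+1 :> algC.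
  rewrite -[LHS]/(map_fps phi (\prod_(j < K) shift j (profile_series (fun i : 'I_K => 'X_i : {mpoly rat[K]}))) K.+1).
  by rewrite map_prod_shift (eq_profile_series phiX).
by rewrite subrr.
Qed.

Definition generic_R (i : nat) : {mpoly rat[K]} :=
  if (2 <= i <= K.+1)%N then 'X_(inord (i - 2)) else (i == 0%N)%:R.

Lemma generic_RE (i : 'I_K) : generic_R i.+2 = 'X_i.
Proof. by rewrite /generic_R /= ltnS ltn_ord subSS subn1 /= inord_val. Qed.

(** By kerov_generic_profile the difference E of the two sides vanishes after the
    substitution of the cumulants of the generic profile, which can be specialised
    to any rational values of the cumulants by cumulant_surjective. *)
Lemma kerov_generic_cumulants :
  kerov_eval generic_R Sigma = - (K%:R^-1 : rat) *: kerov_series generic_R K K.+1.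
Proof.
have [R R0 eqR] := cumulant_exists (fun i : 'I_K => 'X_i : {mpoly rat[K]}).
apply/eqP; rewrite -subr_eq0; apply/eqP; set E := _ - _.
pose phi : {rmorphism {mpoly rat[K]} -> {mpoly rat[K]}} :=
  mmap (@mpolyC K rat) (fun i : 'I_K => R i.+2).
have phiX (i : 'I_K) : phi 'X_i = R i.+2 by rewrite /phi /= mmapX mmap1U.
have phiE0 : phi E = 0.
  rewrite /E rmorphB rmorph_kerov rmorphZ_rat.
  rewrite (@agrees_kerov_series _ _ phi K.+1 generic_R R) // => [|i i_bnd]; last first.
    have lt_i : (i - 2 < K)%N by case/andP: i_bnd => ? ?; rewrite ltn_subLR.
    rewrite /generic_R i_bnd phiX inordK //; congr R.
    by case/andP: i_bnd => le2 _; rewrite -addn2 subnK.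
  rewrite -(kerov_generic_profile R0 eqR) -[X in X - _](@eq_mmap _ _ _ intr intr (fun i : 'I_K => R i.+2)) ?subrr //.
  by move=> i; rewrite generic_RE phiX.
apply: mpoly_eq0_of_strict => v _ _; set pt := fun i => _.
pose T : fps algC := fun n => if n is n'.+2 then ratr (pt (inord n')) else (n == 0%N)%:R.
have char0 n : n.+1%:R != 0 :> algC by rewrite pnatr_eq0.
have [u u_def] := @cumulant_surjective algC char0 K T erefl erefl.
pose psi : {rmorphism {mpoly rat[K]} -> algC} := mmap (@ratr algC) u.
have psiX : psi \o (fun i : 'I_K => 'X_i) =1 u by move=> i; rewrite /psi /= mmapX mmap1U.
have psiR m : (m <= K.+1)%N -> psi (R m) = T m.
  have d0 : cumulant_defect u (map_fps psi R) = 0.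
    by rewrite /cumulant_defect (eq_cumulant psiX (map_cumulant_eq psi eqR)) subrr.
  apply: (cumulant_unique (u := u) (R := map_fps psi R)) => //.
    by rewrite /map_fps R0 rmorph1.
  by move=> i le_i; rewrite d0 u_def.
apply: (fmorph_inj (@ratr algC)); rewrite rmorph0 -(rmorph0 psi) -phiE0.
rewrite [RHS]rmorph_mmap [LHS]rmorph_mmap; apply: eq_mmap => [c|i] /=.
  by rewrite mmapC.
have lt_i : (i < K)%N := ltn_ord i.
rewrite (psiR i.+2) // /T; congr (ratr (pt _)).
by apply: val_inj; rewrite /= inordK.
Qed.

Theorem kerov_formula (A : comAlgType rat) (R : nat -> A) :
  kerov_eval R Sigma = - (K%:R^-1 : rat) *: kerov_series R K K.+1.
Proof.
pose phi : {rmorphism {mpoly rat[K]} -> A} := mmap (in_alg A) (fun i : 'I_K => R i.+2).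
have phiX (i : 'I_K) : phi 'X_i = R i.+2 by rewrite /phi /= mmapX mmap1U.
have := congr1 phi kerov_generic_cumulants; rewrite rmorph_kerov rmorphZ_rat.
rewrite (@agrees_kerov_series _ _ phi K.+1 generic_R R) // => [<-|i i_bnd]; last first.
  have lt_i : (i - 2 < K)%N by case/andP: i_bnd => ? ?; rewrite ltn_subLR.
  rewrite /generic_R i_bnd phiX inordK //; congr R.
  by case/andP: i_bnd => le2 _; rewrite -addn2 subnK.
by apply: eq_mmap => // i; rewrite generic_RE phiX.
Qed.

(** A may have zero divisors, but the roots differ by invertible scalars, so the
    corresponding linear factors can be divided out one at a time. *)
Lemma poly_eq0_of_nat_values (A : comAlgType rat) (p : {poly A}) m :
  (forall n, (m <= n)%N -> p.[n%:R] = 0) -> p = 0.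
Proof.
have [d le_d] := ubnP (size p); elim: d => // d IHd in p m le_d *; move=> p0.
have /factor_theorem[q pq] : root p m%:R by apply/eqP/p0.
apply/eqP/negPn/negP => nz_p.
have q0 : q = 0.
  apply: (IHd q m.+1) => [|n lt_mn].
    move: le_d; rewrite pq size_Mmonic ?monicXsubC ?size_XsubC ?addn2 //.
    by apply: contraNneq nz_p => q0; rewrite pq q0 mul0r.
  have := p0 n (ltnW lt_mn); rewrite pq hornerM hornerXsubC -natrB ?(ltnW lt_mn) //.
  rewrite mulr_natr; case def: (n - m)%N => [|i]; last exact: natalg_torsion_free.
  by move: lt_mn; rewrite -subn_gt0 def.
by rewrite pq q0 mul0r eqxx in nz_p.
Qed.

(** Replacing R_i by c^i R_i turns the left-hand side of kerov_formula into a
    polynomial in c whose coefficients are the weight parts, and multiplies the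
    coefficient of u^b in the series by c^(k+2-b).  The two polynomials, made
    integral by a power of c, agree at all positive integers c. *)
Lemma kerov_weight_formula (A : comAlgType rat) (R : nat -> A) b : (b <= K.+1)%N ->
  weight_part R Sigma (K.+1 - b) = - (K%:R^-1 : rat) *: (kerov_series_u R K K.+1)`_b.
Proof.
move=> le_b; rewrite /weight_part; set W := mmap _ _ _; set g := kerov_series_u R K K.+1.
(* Adding b ensures b <= M, so that the coefficient of index b is in rg. *)
pose M := (size g + b)%N.
pose rg : {poly A} := \sum_(i < M.+1) g`_i *: 'X^(M - i).
have eqP' : 'X^M * W = - (K%:R^-1)%:A%:P * ('X^(K.+1) * rg).
  apply/eqP; rewrite -subr_eq0; apply/eqP; apply: (@poly_eq0_of_nat_values _ _ 1) => n n_gt0.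
  pose c : rat := n%:R; have c_neq0 : c != 0 by rewrite pnatr_eq0 -lt0n.
  have cE : n%:R = c%:A :> A by rewrite /c scaler_nat.
  have WE : W.[n%:R] = kerov_eval (fun i => c ^+ i *: R i) Sigma.
    rewrite -[LHS]/(horner_eval n%:R W) /W [LHS]rmorph_mmap; apply: eq_mmap => [z|i] /=.
      exact: rmorph_int.
    by rewrite /horner_eval hornerM hornerC hornerXn cE exprZn expr1n mulr_algr.
  have rgE : rg.[n%:R] = c ^+ M *: g.[c^-1%:A].
    rewrite horner_sum (@horner_coef_wide _ M.+1); last by rewrite leqW // leq_addr.
    rewrite scaler_sumr; apply: eq_bigr => i _; have le_i : (i <= M)%N by rewrite -ltnS.
    rewrite hornerZ hornerXn cE !exprZn !expr1n !mulr_algr scalerA; congr (_ *: _).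
    by rewrite exprVn expfB_cond // (negPf c_neq0).
  have XnE d : ('X^d : {poly A}).[n%:R] = (c ^+ d)%:A by rewrite hornerXn cE exprZn expr1n.
  rewrite hornerD hornerN (hornerM 'X^M) (hornerM (- _)) (hornerM 'X^(K.+1)) hornerN hornerC.
  rewrite !XnE WE rgE kerov_formula (scaled_kerov_series R c_neq0) -/g.
  rewrite -scaleNr !mulr_algl !scalerA; apply/eqP; rewrite subr_eq0; apply/eqP.
  by congr (_ *: _); rewrite -mulrA mulrC -mulrA.
have := congr1 (fun p : {poly A} => p`_(M + (K.+1 - b))) eqP'.
rewrite coefXnM ltnNge leq_addr /= addKn => ->.
rewrite -polyCN coefCM coefXnM addnBA // addnC -addnBA ?leq_addl // ltnNge leq_addr /= addKn.
rewrite coef_sum -[X in X * _]scaleNr mulr_algl; congr (_ *: _).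
have lt_b : (b < M.+1)%N by rewrite ltnS leq_addl.
rewrite (bigD1 (Ordinal lt_b)) //= coefZ coefXn eqxx mulr1 big1 ?addr0 // => i ne_i.
rewrite coefZ coefXn; case: eqP => [e|]; rewrite ?mulr0 //.
case/eqP: ne_i; apply: val_inj => /=; have := ltn_ord i; lia.
Qed.
End Main.

Theorem theorem2p3 (n k : nat) (hn : (1 <= n)%N) (hk : (2 * n - 1 <= k)%N)
    (Sigma : {mpoly int[k]}) (hSigma : is_kerov_polynomial Sigma) :
  weight_part indet Sigma (k + 1 - 2 * n)
    = - (k%:R^-1 : rat) *: (kerov_series_u indet k k.+1)`_(2 * n)
  /\ kerov_eval indet Sigma = - (k%:R^-1 : rat) *: kerov_series indet k k.+1.
Proof.
case: k Sigma hSigma hk => [|k] Sigma hSigma hk; first by lia.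
split; last exact: kerov_formula.
by rewrite addn1; apply: kerov_weight_formula => //; lia.
Qed.
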